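(* Let $\mathcal C$ be a braided monoidal category, let $\mathsf C$ be the Catalan simplicial set, and let $\mathsf M_{12}$ be the simplicial set associated to $\mathcal C$ (both described in the context). There is a bijection between simplicial maps $\mathsf C\to\mathsf M_{12}$ and multiplier bimonoids in $\mathcal C$.
   Context: **Notation.** $\mathcal C$ is a braided monoidal category, not assumed strict, but associativity and unit isomorphisms are omitted (relying on coherence). The monoidal unit is $I$; the monoidal product is denoted by juxtaposition, with $A^n$ the iterated monoidal product. The braiding is $c$ (components $c_{X,Y}\colon XY\to YX$, subscripts omitted); $c^{-1}$ denotes the inverse of the appropriate component. The composite of $f\colon A\to B$ and $g\colon B\to C$ is written $g.f$; $1$ denotes identity morphisms. Juxtaposed morphisms such as $1t$, $c1$ denote monoidal products. A semigroup in $\mathcal C$ is an object $A$ with an associative morphism $m\colon A^2\to A$. $\mathcal C^{\mathsf{rev}}$ is $\mathcal C$ with reversed monoidal product and the same braiding $c$. **Fusion morphisms.** A fusion morphism on $A$ in $\mathcal C$ is a morphism $t\colon A^2\to A^2$ such that $(1t).(t1)=(t1).(c^{-1}1).(1t).(c1).(1t)\colon A^3\to A^3$. A morphism $e\colon A\to I$ is a counit of $t$ if $(1e).t=1e$. Explicitly in terms of $\mathcal C$, a fusion morphism in $\mathcal C^{\mathsf{rev}}$ is $t\colon A^2\to A^2$ with $(t1).(1t)=(1t).(1c^{-1}).(t1).(1c).(t1)$, and $e$ is a counit of it if $(e1).t=e1$. **Multiplier bimonoids.** A multiplier bimonoid in $\mathcal C$ is a tuple $(A,t_1,t_2,e)$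 where $A$ is an object of $\mathcal C$, $t_1\colon A^2\to A^2$ is a fusion morphism in $\mathcal C$ and $t_2\colon A^2\to A^2$ is a fusion morphism in $\mathcal C^{\mathsf{rev}}$ with a common counit $e\colon A\to I$, such that $$(1t_1).(t_21)=(t_21).(1t_1)\colon A^3\to A^3,\qquad (1e).t_2=(e1).t_1\colon A^2\to A.$$ **Simplicial conventions.** Simplicial sets have face maps $d_i$ and degeneracy maps $s_i$. An $n$-boundary is an $(n+1)$-tuple $\{w_0,\dots,w_n\}$ of $(n-1)$-simplices with $d_j(w_i)=d_i(w_{j+1})$ for all $0\le i\le j<n$; a filler is an $n$-simplex $w$ with $d_i(w)=w_i$ for all $i$, and one writes $w=(w_0,\dots,w_n)$ when it is the unique filler. Simplices in given degrees are generated coskeletally if every boundary in those degrees has a unique filler. A 2-simplex $w$ has edges $w_{12}=d_0(w)$, $w_{02}=d_1(w)$, $w_{01}=d_2(w)$ and its boundary is written $\{w_{12},w_{02},w_{01}\}$; the boundary of a 3-simplex is written $\{w_{123},w_{023},w_{013},w_{012}\}$ (faces $d_0,d_1,d_2,d_3$), where the edges of $w_{ijk}$ are indexed $jk$, $ik$, $ij$. **Catalan simplicial set $\mathsf C$.** It has a single 0-simplex $\ast$; two 1-simplices, $s_0(\ast)$ and a non-degenerate one $\alpha$; three degenerate 2-simplices $s_0s_0(\ast)=s_1s_0(\ast)$, $s_0(\alpha)$, $s_1(\alpha)$ and two non-degenerate 2-simplices: $\tau$ with $d_0\tau=d_1\tau=d_2\tau=\alpha$, and $\varepsilon$ with $d_0\varepsilon=d_2\varepsilon=s_0(\ast)$,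 $d_1\varepsilon=\alpha$. All simplices of dimension $n>2$ are generated coskeletally. **Simplicial set $\mathsf M_1$.** It has a single 0-simplex $\ast$. Its 1-simplices are the semigroups $(A,m)$ in $\mathcal C$. The 2-simplices with boundary $\{A_{12},A_{02},A_{01}\}$ (with multiplications $m_{12},m_{02},m_{01}$) are the morphisms $\varphi\colon A_{02}A_{12}\to A_{01}A_{12}$ in $\mathcal C$ such that $$\varphi.(1m_{12})=(1m_{12}).(\varphi 1),\qquad \varphi.(m_{02}1)=(m_{01}1).(c^{-1}1).(1\varphi).(c1).(1\varphi).$$ A 3-boundary $\{\varphi_{123},\varphi_{023},\varphi_{013},\varphi_{012}\}$ has precisely one filler if $$(1\varphi_{123}).(\varphi_{013}1)=(\varphi_{012}1).(c^{-1}1).(1\varphi_{023}).(c1).(1\varphi_{123})\colon A_{03}A_{13}A_{23}\to A_{01}A_{12}A_{23},$$ and no filler otherwise. All higher simplices are generated coskeletally. The degenerate 1-simplex is $I$ (as trivial semigroup). The 2-simplex $s_0(A,m)$ (with $A_{12}=A_{02}=A$, $A_{01}=I$) is $m\colon AA\to IA\cong A$; the 2-simplex $s_1(A,m)$ (with $A_{12}=I$, $A_{02}=A_{01}=A$) is $1\colon A\to A$. On higher simplices the degeneracy maps are determined by uniqueness of the filler. **Simplicial set $\mathsf M_2$.** It has a single 0-simplex $\ast$ and its 1-simplices are the semigroups in $\mathcal C$. The 2-simplices with boundary $\{A_{12},A_{02},A_{01}\}$ are the morphisms $\psi\colon A_{01}A_{02}\to A_{01}A_{12}$ in $\mathcal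 C$ such that $$\psi.(m_{01}1)=(m_{01}1).(1\psi),\qquad \psi.(1m_{02})=(1m_{12}).(1c^{-1}).(\psi1).(1c).(\psi1).$$ A 3-boundary $\{\psi_{123},\psi_{023},\psi_{013},\psi_{012}\}$ has precisely one filler if $$(\psi_{012}1).(1\psi_{023})=(1\psi_{123}).(1c^{-1}).(\psi_{013}1).(1c).(\psi_{012}1)\colon A_{01}A_{02}A_{03}\to A_{01}A_{12}A_{23},$$ and no filler otherwise. All higher simplices are generated coskeletally. The degenerate 1-simplex is $I$; $s_0(A,m)$ is $1\colon A\to A$ (with $A_{01}=I$, $A_{12}=A_{02}=A$) and $s_1(A,m)$ is $m\colon AA\to AI\cong A$ (with $A_{12}=I$, $A_{01}=A_{02}=A$). On higher simplices the degeneracy maps are determined by uniqueness of the filler. **Simplicial set $\mathsf M_{12}$.** It has a single 0-simplex $\ast$, and its 1-simplices are the semigroups in $\mathcal C$. The 2-simplices are pairs $(\varphi\vert\psi)$ of a 2-simplex $\varphi$ of $\mathsf M_1$ and a 2-simplex $\psi$ of $\mathsf M_2$ with common boundary $\{A_{12},A_{02},A_{01}\}$ such that $$(m_{01}1).(1\varphi)=(1m_{12}).(\psi1)\colon A_{01}A_{02}A_{12}\to A_{01}A_{12}.$$ The 3-simplices are pairs $(\varphi_{123},\varphi_{023},\varphi_{013},\varphi_{012}\vert\psi_{123},\psi_{023},\psi_{013},\psi_{012})$ of a 3-simplex of $\mathsf M_1$ and a 3-simplex of $\mathsf M_2$ such that each $(\varphi_{ijk}\vert\psi_{ijk})$ is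 a 2-simplex of $\mathsf M_{12}$ and $$(\psi_{012}1).(1\varphi_{023})=(1\varphi_{123}).(\psi_{013}1)\colon A_{01}A_{03}A_{23}\to A_{01}A_{12}A_{23}.$$ The face and degeneracy maps act componentwise on pairs, and higher simplices are generated coskeletally. *)

(* Defs.v *)
From HB Require Import structures.
From mathcomp Require Import all_boot zify.
From mathcomp Require Import boolp.
Set Implicit Arguments.
Unset Strict Implicit.
Unset Printing Implicit Defensive.

Declare Scope moncat_scope.
Delimit Scope moncat_scope with C.
Local Open Scope moncat_scope.

Record category := Category {
  ob :> Type;
  hom : ob -> ob -> Type;
  idm : forall A, hom A A;
  comp : forall A B C, hom B C -> hom A B -> hom A C;
  compA : forall A B C D (h : hom C D) (g : hom B C) (f : hom A B),
    comp h (comp g f) = comp (comp h g) f;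
  comp1m : forall A B (f : hom A B), comp (idm B) f = f;
  compm1 : forall A B (f : hom A B), comp f (idm A) = f }.

Arguments idm {c} A.
Arguments comp {c A B C} g f.

Notation "g ∘ f" := (comp g f) (at level 40, left associativity) : moncat_scope.
Notation "1_ A" := (idm A) (at level 8, A at level 2, format "1_ A") : moncat_scope.

Record monoidal_category := MonoidalCategory {
  mon_cat :> category;
  unit_ob : mon_cat;
  tens : mon_cat -> mon_cat -> mon_cat;
  tensm : forall A A' B B' : mon_cat,
    hom A A' -> hom B B' -> hom (tens A B) (tens A' B');
  assoc : forall A B C, hom (tens (tens A B) C) (tens A (tens B C));
  assocV : forall A B C, hom (tens A (tens B C)) (tens (tens A B) C);
  lunit : forall A, hom (tens unit_ob A) A;
  lunitV : forall A, hom A (tens unit_ob A);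
  runit : forall A, hom (tens A unit_ob) A;
  runitV : forall A, hom A (tens A unit_ob);
  tensm1 : forall A B, tensm 1_A 1_B = 1_(tens A B);
  tensm_comp : forall A A' A'' B B' B'' (f' : hom A' A'') (f : hom A A')
      (g' : hom B' B'') (g : hom B B'),
    tensm (f' ∘ f) (g' ∘ g) = tensm f' g' ∘ tensm f g;
  assoc_nat : forall A A' B B' C C' (f : hom A A') (g : hom B B') (h : hom C C'),
    assoc A' B' C' ∘ tensm (tensm f g) h = tensm f (tensm g h) ∘ assoc A B C;
  lunit_nat : forall A A' (f : hom A A'),
    lunit A' ∘ tensm 1_unit_ob f = f ∘ lunit A;
  runit_nat : forall A A' (f : hom A A'),
    runit A' ∘ tensm f 1_unit_ob = f ∘ runit A;
  assocK : forall A B C, assocV A B C ∘ assoc A B C = 1_(tens (tens A B) C);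
  assocVK : forall A B C, assoc A B C ∘ assocV A B C = 1_(tens A (tens B C));
  lunitK : forall A, lunitV A ∘ lunit A = 1_(tens unit_ob A);
  lunitVK : forall A, lunit A ∘ lunitV A = 1_A;
  runitK : forall A, runitV A ∘ runit A = 1_(tens A unit_ob);
  runitVK : forall A, runit A ∘ runitV A = 1_A;
  pentagon : forall A B C D,
    assoc A B (tens C D) ∘ assoc (tens A B) C D
    = tensm 1_A (assoc B C D) ∘ assoc A (tens B C) D ∘ tensm (assoc A B C) 1_D;
  triangle : forall A B,
    tensm 1_A (lunit B) ∘ assoc A unit_ob B = tensm (runit A) 1_B }.

Arguments unit_ob {m}.
Arguments tens {m} A B.
Arguments tensm {m A A' B B'} f g.
Arguments assoc {m} A B C.
Arguments assocV {m} A B C.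
Arguments lunit {m} A.
Arguments lunitV {m} A.
Arguments runit {m} A.
Arguments runitV {m} A.

Notation "A ⊗ B" := (tens A B) (at level 35, right associativity) : moncat_scope.
Notation "f ⊠ g" := (tensm f g) (at level 35, right associativity) : moncat_scope.
Notation "𝟙" := unit_ob : moncat_scope.

Record braided_category := BraidedCategory {
  br_mon :> monoidal_category;
  braid : forall A B : br_mon, hom (A ⊗ B) (B ⊗ A);
  braidV : forall A B : br_mon, hom (B ⊗ A) (A ⊗ B);
  braid_nat : forall (A A' B B' : br_mon) (f : hom A A') (g : hom B B'),
    braid A' B' ∘ (f ⊠ g) = (g ⊠ f) ∘ braid A B;
  braidK : forall A B, braidV A B ∘ braid A B = 1_(A ⊗ B);
  braidVK : forall A B, braid A B ∘ braidV A B = 1_(B ⊗ A);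
  hexagon1 : forall A B C,
    assoc B C A ∘ braid A (B ⊗ C) ∘ assoc A B C
    = (1_B ⊠ braid A C) ∘ assoc B A C ∘ (braid A B ⊠ 1_C);
  hexagon2 : forall A B C,
    assocV C A B ∘ braid (A ⊗ B) C ∘ assocV A B C
    = (braid A C ⊠ 1_B) ∘ assocV A C B ∘ (1_A ⊠ braid B C) }.

Arguments braid {b} A B.
Arguments braidV {b} A B.

Section Coherence.
Variable M : monoidal_category.
Implicit Types A B C D : M.

Lemma mon_cancelr A B C (g g' : hom B C) (f : hom A B) (f' : hom B A) :
  f ∘ f' = 1_B -> g ∘ f = g' ∘ f -> g = g'.
Proof.
by move=> ff' e; rewrite -(compm1 g) -(compm1 g') -ff' !compA e.
Qed.

Lemma mon_cancell A B C (g : hom B C) (g' : hom C B) (f f' : hom A B) :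
  g' ∘ g = 1_B -> g ∘ f = g ∘ f' -> f = f'.
Proof.
by move=> gg e; rewrite -(comp1m f) -(comp1m f') -gg -!compA e.
Qed.

Lemma tens_compl A B B' B'' (g : hom B' B'') (f : hom B B') :
  1_A ⊠ (g ∘ f) = (1_A ⊠ g) ∘ (1_A ⊠ f).
Proof. by rewrite -tensm_comp comp1m. Qed.

Lemma tens_compr A B B' B'' (g : hom B' B'') (f : hom B B') :
  (g ∘ f) ⊠ 1_A = (g ⊠ 1_A) ∘ (f ⊠ 1_A).
Proof. by rewrite -tensm_comp comp1m. Qed.

Lemma mon_interchange A A' B B' (f : hom A A') (g : hom B B') :
  (1_A' ⊠ g) ∘ (f ⊠ 1_B) = (f ⊠ 1_B') ∘ (1_A ⊠ g).
Proof. by rewrite -!tensm_comp !comp1m !compm1. Qed.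

Lemma lunit_faithful A B (f g : hom A B) : 1_𝟙 ⊠ f = 1_𝟙 ⊠ g -> f = g.
Proof.
move=> e; apply: (mon_cancelr (lunitVK A)).
by rewrite -!lunit_nat e.
Qed.

Lemma runit_faithful A B (f g : hom A B) : f ⊠ 1_𝟙 = g ⊠ 1_𝟙 -> f = g.
Proof.
move=> e; apply: (mon_cancelr (runitVK A)).
by rewrite -!runit_nat e.
Qed.

Lemma assocV_nat A A' B B' C C' (f : hom A A') (g : hom B B') (h : hom C C') :
  assocV A' B' C' ∘ (f ⊠ (g ⊠ h)) = ((f ⊠ g) ⊠ h) ∘ assocV A B C.
Proof.
apply: (mon_cancell (assocK A' B' C')).
by rewrite !compA assoc_nat assocVK comp1m -compA assocVK compm1.
Qed.

Lemma lunit_tens A B : lunit (A ⊗ B) ∘ assoc 𝟙 A B = lunit A ⊠ 1_B.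
Proof.
apply: lunit_faithful.
have e1 : assoc 𝟙 (𝟙 ⊗ A) B ∘ (assoc 𝟙 𝟙 A ⊠ 1_B) ∘
   ((assocV 𝟙 𝟙 A ⊠ 1_B) ∘ assocV 𝟙 (𝟙 ⊗ A) B) = 1_(𝟙 ⊗ ((𝟙 ⊗ A) ⊗ B)).
  rewrite compA -(compA (assoc 𝟙 (𝟙 ⊗ A) B)) -tens_compr assocVK tensm1 compm1.
  exact: assocVK.
apply: (mon_cancelr e1); transitivity (assoc 𝟙 A B ∘ ((runit 𝟙 ⊠ 1_A) ⊠ 1_B)).
  by rewrite tens_compl -compA (compA (1_𝟙 ⊠ assoc 𝟙 A B)) -pentagon compA
    triangle assoc_nat tensm1.
by rewrite compA -assoc_nat -compA -tens_compr triangle.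
Qed.

Lemma runit_tens A B : (1_A ⊠ runit B) ∘ assoc A B 𝟙 = runit (A ⊗ B).
Proof.
apply: runit_faithful.
apply: (mon_cancell (assocK A B 𝟙)).
rewrite tens_compr compA assoc_nat -triangle tens_compl.
rewrite -compA -(compA _ (1_A ⊠ assoc B 𝟙 𝟙)) (compA (1_A ⊠ assoc B 𝟙 𝟙)) -pentagon.
by rewrite -triangle -tensm1 compA -assoc_nat -!compA.
Qed.

Lemma lunitI : lunit 𝟙 = runit 𝟙 :> hom (𝟙 ⊗ 𝟙) (𝟙 : M).
Proof.
apply: runit_faithful.
rewrite -triangle -lunit_tens; congr (_ ∘ _).
apply: (mon_cancell (lunitK 𝟙)).
by rewrite lunit_nat.
Qed.

End Coherence.

Section BraidUnit.
Variable M : braided_category.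
Implicit Types A B C D : M.

Lemma lunit_braid A : lunit A ∘ braid A 𝟙 = runit A.
Proof.
apply: runit_faithful.
have iso : braidV A 𝟙 ∘ lunitV A ∘ (lunit A ∘ braid A 𝟙) = 1_(A ⊗ 𝟙).
  by rewrite compA -(compA _ (lunitV A)) lunitK compm1 braidK.
apply: (mon_cancell iso).
have := congr1 (fun x => lunit A ∘ ((1_𝟙 ⊠ lunit A) ∘ x)) (hexagon1 A 𝟙 𝟙).
rewrite !compA -(compA (lunit A) _ (assoc _ _ _)) triangle -lunitI.
rewrite -(compA (lunit A)) -braid_nat compA -(compA _ _ (assoc _ _ _)) triangle.
move=> ->; rewrite -(compA (lunit A) (_ ⊠ _)) -tens_compl lunit_nat.
by rewrite -(compA _ _ (assoc _ _ _)) lunit_tens -[RHS]compA -tens_compr.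
Qed.

Lemma runit_braid A : runit A ∘ braid 𝟙 A = lunit A.
Proof.
apply: lunit_faithful.
have iso : braidV 𝟙 A ∘ runitV A ∘ (runit A ∘ braid 𝟙 A) = 1_(𝟙 ⊗ A).
  by rewrite compA -(compA _ (runitV A)) runitK compm1 braidK.
have triV X Y : (runit X ⊠ 1_Y) ∘ assocV X 𝟙 Y = 1_X ⊠ lunit Y.
  by rewrite -triangle -compA assocVK compm1.
apply: (mon_cancell iso).
have := congr1 (fun x => runit A ∘ ((runit A ⊠ 1_𝟙) ∘ x)) (hexagon2 𝟙 𝟙 A).
rewrite !compA -(compA (runit A) _ (assocV _ _ _)) triV.
rewrite -(compA (runit A)) -braid_nat lunitI compA -(compA _ _ (assocV _ _ _)) triV.
move=> ->; rewrite -(compA (runit A) (_ ⊠ _)) -tens_compr runit_nat.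
rewrite -(compA _ _ (assocV _ _ _)) -runit_tens -(compA _ (assoc _ _ _)) assocVK.
by rewrite compm1 -[RHS]compA -tens_compl.
Qed.
End BraidUnit.

(** * Simplicial sets, given by faces and degeneracies *)

(** [ordwid i] has the same value as [i] and [ordup i] has value [i.+1]. *)
Notation ordwid := (widen_ord (leqnSn _)).
Notation ordup := (lift ord0).

(** The simplicial identities, on consecutive levels [X0], [X1], [X2] of
    dimensions [n], [n.+1], [n.+2]:
    - [dd_ax]    d_i d_(j+1) = d_j d_i        for i <= j,
    - [ss_ax]    s_i s_j = s_(j+1) s_i        for i <= j,
    - [ds_eq_ax] d_j s_j = 1 = d_(j+1) s_j,
    - [ds_ax]    d_i s_(j+1) = s_j d_i        for i <= j,
                 d_(i+1) s_j = s_j d_i        for j < i. *)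
Definition dd_ax n (X0 X1 X2 : Type) (d1 : 'I_n.+2 -> X1 -> X0)
    (d2 : 'I_n.+3 -> X2 -> X1) : Prop :=
  forall (i j : 'I_n.+2) x, i <= j -> d1 i (d2 (ordup j) x) = d1 j (d2 (ordwid i) x).

Definition ss_ax n (X0 X1 X2 : Type) (s0 : 'I_n.+1 -> X0 -> X1)
    (s1 : 'I_n.+2 -> X1 -> X2) : Prop :=
  forall (i j : 'I_n.+1) x, i <= j -> s1 (ordwid i) (s0 j x) = s1 (ordup j) (s0 i x).

Definition ds_eq_ax n (X0 X1 : Type) (d1 : 'I_n.+2 -> X1 -> X0)
    (s0 : 'I_n.+1 -> X0 -> X1) : Prop :=
  forall (j : 'I_n.+1) x, d1 (ordwid j) (s0 j x) = x /\ d1 (ordup j) (s0 j x) = x.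

Definition ds_ax n (X0 X1 X2 : Type)
    (d1 : 'I_n.+2 -> X1 -> X0) (d2 : 'I_n.+3 -> X2 -> X1)
    (s0 : 'I_n.+1 -> X0 -> X1) (s1 : 'I_n.+2 -> X1 -> X2) : Prop :=
  forall (i : 'I_n.+2) (j : 'I_n.+1) x,
    (i <= j -> d2 (ordwid i) (s1 (ordup j) x) = s0 j (d1 i x)) /\
    (j < i -> d2 (ordup i) (s1 (ordwid j) x) = s0 j (d1 i x)).

Record sset := SSet {
  simplex :> nat -> Type;
  face : forall n, 'I_n.+2 -> simplex n.+1 -> simplex n;
  degen : forall n, 'I_n.+1 -> simplex n -> simplex n.+1;
  sset_dd : forall n, dd_ax (@face n) (@face n.+1);
  sset_ss : forall n, ss_ax (@degen n) (@degen n.+1);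
  sset_ds_eq : forall n, ds_eq_ax (@face n) (@degen n);
  sset_ds : forall n, ds_ax (@face n) (@face n.+1) (@degen n) (@degen n.+1) }.

Arguments face {s n} i x.
Arguments degen {s n} i x.

Record smap (X Y : sset) := SMap {
  smap_fun :> forall n, X n -> Y n;
  smap_face : forall n (i : 'I_n.+2) (x : X n.+1),
    smap_fun (face i x) = face i (smap_fun x);
  smap_degen : forall n (i : 'I_n.+1) (x : X n),
    smap_fun (degen i x) = degen i (smap_fun x) }.

(** If [d] is the face operation from dimension [n.+1] to dimension [n], then
    [boundary d] is the type of [n.+2]-boundaries, and [bface] gives its members. *)
Definition boundary n (X0 X1 : Type) (d : 'I_n.+2 -> X1 -> X0) : Type :=
  {w : 'I_n.+3 -> X1 |
    forall i j : 'I_n.+2, i <= j -> d j (w (ordwid i)) = d i (w (ordup j))}.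

Definition bface n (X0 X1 : Type) (d : 'I_n.+2 -> X1 -> X0)
  (i : 'I_n.+3) (w : boundary d) : X1 := sval w i.

Lemma boundary_eq n (X0 X1 : Type) (d : 'I_n.+2 -> X1 -> X0) (w w' : boundary d) :
  (forall i, bface i w = bface i w') -> w = w'.
Proof.
case: w w' => [w p] [w' p'] /= e; apply: eq_exist.
by apply: functional_extensionality_dep.
Qed.

Lemma wid_inord n i : i < n.+1 -> ordwid (inord i : 'I_n.+1) = inord i.
Proof. by move=> h; apply: val_inj; rewrite /= !inordK //; lia. Qed.

Lemma up_inord n i : i < n.+1 -> ordup (inord i : 'I_n.+1) = inord i.+1.
Proof. by move=> h; apply: val_inj; rewrite /= /bump !inordK //; lia. Qed.

Section BoundaryDegeneracies.
Variables (n : nat) (X0 X1 X2 : Type).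
Variables (d1 : 'I_n.+2 -> X1 -> X0) (d2 : 'I_n.+3 -> X2 -> X1).
Variables (s0 : 'I_n.+1 -> X0 -> X1) (s1 : 'I_n.+2 -> X1 -> X2).
Hypotheses (dd : dd_ax d1 d2) (ss : ss_ax s0 s1).
Hypotheses (ds_eq : ds_eq_ax d2 s1) (ds : ds_ax d1 d2 s0 s1).

(** The [k]-th face of the degenerate simplex s_j(x), as forced by the
    simplicial identities. *)
Definition degen_faces (j : nat) (x : X2) (k : nat) : X2 :=
  if k < j then s1 (inord j.-1) (d2 (inord k) x)
  else if k <= j.+1 then x
  else s1 (inord j) (d2 (inord k.-1) x).

Let ddN (i j : nat) x : i <= j -> j < n.+2 ->
  d1 (inord i) (d2 (inord j.+1) x) = d1 (inord j) (d2 (inord i) x).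
Proof.
move=> ij jn; have := @dd (inord i) (inord j) x.
by rewrite up_inord ?wid_inord ?inordK //; [apply | lia | lia].
Qed.

Let ds_ltN (i j : nat) x : i <= j -> j < n.+1 ->
  d2 (inord i) (s1 (inord j.+1) x) = s0 (inord j) (d1 (inord i) x).
Proof.
move=> ij jn; have [+ _] := @ds (inord i) (inord j) x.
by rewrite up_inord ?wid_inord ?inordK //; [apply | lia | lia].
Qed.

Let ds_gtN (i j : nat) x : j < i -> i < n.+2 ->
  d2 (inord i.+1) (s1 (inord j) x) = s0 (inord j) (d1 (inord i) x).
Proof.
move=> ij jn; have [_] := @ds (inord i) (inord j) x.
by rewrite up_inord ?wid_inord ?inordK //; [apply | lia | lia].
Qed.

Let ds_eqN (i j : nat) x : j < n.+2 -> j <= i <= j.+1 ->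
  d2 (inord i) (s1 (inord j) x) = x.
Proof.
move=> jn ij; have [] := @ds_eq (inord j) x.
rewrite up_inord ?wid_inord // => e1 e2.
by have [->|->] : i = j \/ i = j.+1 by lia.
Qed.

Let ssN (i j : nat) x : i <= j -> j < n.+1 ->
  s1 (inord i) (s0 (inord j) x) = s1 (inord j.+1) (s0 (inord i) x).
Proof.
move=> ij jn; have := @ss (inord i) (inord j) x.
by rewrite up_inord ?wid_inord ?inordK //; [apply | lia | lia].
Qed.

Lemma degen_faces_boundary (k i j : nat) (x : X2) :
  k < n.+3 -> j < n.+3 -> i <= j ->
  d2 (inord j) (degen_faces k x i) = d2 (inord i) (degen_faces k x j.+1).
Proof.
move=> lk lj ij; rewrite /degen_faces /=; have li : i < n.+3 by lia.
case: (ltnP i k) => [ik|ki].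
  case: k lk ik => // k lk ik /=.
  case: (ltnP j.+1 k.+1) => [jk|kj].
    by case: k lk ik jk => // k lk ik jk; rewrite !ds_ltN 1?ddN //; lia.
  case: (leqP j.+1 k.+2) => [jk|{}kj]; first by rewrite ds_eqN //; lia.
  case: j ij lj kj => // j ij lj kj /=.
  by rewrite ds_gtN ?ds_ltN 1?ddN //; lia.
have -> : (j.+1 < k) = false by lia.
case: (leqP i k.+1) => [ik|{}ki].
  case: (leqP j.+1 k.+1) => [jk|kj]; first by congr (d2 (inord _) _); lia.
  by rewrite ds_eqN //; lia.
have -> : (j.+1 <= k.+1) = false by lia.
case: i ij li ki => // i ij li ki; case: j ij lj => // j ij lj /=.
by rewrite !ds_gtN 1?ddN //; lia.
Qed.

Lemma bdegen_subproof (k : 'I_n.+3) (x : X2) (i j : 'I_n.+3) : i <= j ->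
  d2 j (degen_faces k x (ordwid i)) = d2 i (degen_faces k x (ordup j)).
Proof.
move=> ij; have := degen_faces_boundary x (ltn_ord k) (ltn_ord j) ij.
by rewrite !inord_val.
Qed.

Definition bdegen (j : 'I_n.+3) (x : X2) : boundary d2 :=
  exist _ (fun k : 'I_n.+4 => degen_faces j x k) (@bdegen_subproof j x).

Lemma bdd : dd_ax d2 (@bface _ _ _ d2).
Proof. by move=> i j [w wP] ij; rewrite /bface /= wP. Qed.

Lemma bds_eq : ds_eq_ax (@bface _ _ _ d2) bdegen.
Proof.
move=> j x; rewrite /bface /= /degen_faces /= /bump /= add1n ltnn leqnSn.
by rewrite leqnn ltnNge leqnSn.
Qed.

Lemma bds : ds_ax d2 (@bface _ _ _ d2) s1 bdegen.
Proof.
move=> i j x; rewrite /bface /= /degen_faces /= /bump /= !add1n; split=> ij.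
  by rewrite ltnS ij /= !inord_val.
by rewrite ltnNge ltnW ?(leqW ij) //= ltnS leqNgt ij /= !inord_val.
Qed.

Lemma degen_faces_comm (i j k : nat) x : i <= j -> j < n.+2 -> k < n.+4 ->
  degen_faces i (s1 (inord j) x) k = degen_faces j.+1 (s1 (inord i) x) k.
Proof.
move=> ij lj lk; have li : i < n.+2 by lia.
rewrite /degen_faces /=.
case: (ltnP k i) => [ki|ik].
  have -> : k < j.+1 by lia.
  case: i ki li ij => // i ki li ij; case: j lj ij => // j lj ij /=.
  by rewrite !ds_ltN 1?ssN //; lia.
case: (leqP k i.+1) => [ki|{}ik].
  case: (ltnP k j.+1) => [kj|jk]; first by rewrite ds_eqN //; lia.
  have -> : k <= j.+2 by lia.
  by congr (s1 (inord _) _); lia.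
case: k lk ik => // k lk ik /=.
case: (ltnP k.+1 j.+1) => [kj|jk].
  case: j kj lj ij => // j kj lj ij.
  by rewrite ds_ltN ?ds_gtN 1?ssN //; lia.
case: (leqP k.+1 j.+2) => [kj|{}jk]; first by rewrite ds_eqN //; lia.
case: k lk ik jk => // k lk ik jk.
by rewrite !ds_gtN 1?ssN //; lia.
Qed.

Lemma bss : ss_ax s1 bdegen.
Proof.
move=> i j x ij; apply: boundary_eq => k.
have := degen_faces_comm x ij (ltn_ord j) (ltn_ord k).
by rewrite !inord_val /bface /= /bump add1n.
Qed.

End BoundaryDegeneracies.

(** Four consecutive levels, of dimensions [n], ..., [n.+3], of a simplicial set.
    For [n = 0] this is a 3-truncated simplicial set. *)
Record trunc3 n := Trunc3 {
  tlevel0 : Type; tlevel1 : Type; tlevel2 : Type; tlevel3 : Type;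
  tface1 : 'I_n.+2 -> tlevel1 -> tlevel0;
  tface2 : 'I_n.+3 -> tlevel2 -> tlevel1;
  tface3 : 'I_n.+4 -> tlevel3 -> tlevel2;
  tdegen0 : 'I_n.+1 -> tlevel0 -> tlevel1;
  tdegen1 : 'I_n.+2 -> tlevel1 -> tlevel2;
  tdegen2 : 'I_n.+3 -> tlevel2 -> tlevel3;
  t_dd1 : dd_ax tface1 tface2;
  t_dd2 : dd_ax tface2 tface3;
  t_ss0 : ss_ax tdegen0 tdegen1;
  t_ss1 : ss_ax tdegen1 tdegen2;
  t_ds_eq0 : ds_eq_ax tface1 tdegen0;
  t_ds_eq1 : ds_eq_ax tface2 tdegen1;
  t_ds_eq2 : ds_eq_ax tface3 tdegen2;
  t_ds1 : ds_ax tface1 tface2 tdegen0 tdegen1;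
  t_ds2 : ds_ax tface2 tface3 tdegen1 tdegen2 }.

(** Drops the lowest level and adds the boundaries of the highest one as simplices
    of the next dimension, so that every such boundary has a unique filler. *)
Definition trunc3_next n (T : trunc3 n) : trunc3 n.+1 :=
  let dd := @t_dd2 n T in let ss := @t_ss1 n T in
  let ds_eq := @t_ds_eq2 n T in let ds := @t_ds2 n T in
  Trunc3 dd (@bdd _ _ _ (@tface3 n T)) ss (bss dd ss ds_eq ds)
    (@t_ds_eq1 n T) ds_eq (bds_eq dd ds_eq ds) ds (bds dd ds_eq ds).

Fixpoint cosk_stage (T : trunc3 0) (n : nat) : trunc3 n :=
  if n is n'.+1 then trunc3_next (cosk_stage T n') else T.

(** The simplicial set with given simplices in dimensions 0 to 3 and all higher
    simplices generated coskeletally. *)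
Definition coskeletal (T : trunc3 0) : sset :=
  @SSet (fun n => tlevel0 (cosk_stage T n))
    (fun n => @tface1 n (cosk_stage T n))
    (fun n => @tdegen0 n (cosk_stage T n))
    (fun n => @t_dd1 n (cosk_stage T n))
    (fun n => @t_ss0 n (cosk_stage T n))
    (fun n => @t_ds_eq0 n (cosk_stage T n))
    (fun n => @t_ds1 n (cosk_stage T n)).

Lemma coskeletal_filler (T : trunc3 0) n
    (w : boundary (@face (coskeletal T) n.+2)) :
  exists! x : coskeletal T n.+4, forall i, face i x = bface i w.
Proof. by exists w; split=> // x wx; apply: boundary_eq => i; rewrite -wx. Qed.

(** * The Catalan simplicial set *)

Inductive catalan1 := cat_pt1 | cat_alpha.

(** [cat_pt1] and [cat_pt2] are the degeneracies of the unique 0-simplex. *)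
Inductive catalan2 :=
  cat_pt2 | cat_s0alpha | cat_s1alpha | cat_tau | cat_eps.

Definition catalan_face1 (i : 'I_2) (x : catalan1) : unit := tt.

Definition catalan_face2 (i : 'I_3) (x : catalan2) : catalan1 :=
  match x, val i with
  | cat_pt2, _ => cat_pt1
  | cat_s0alpha, 2 => cat_pt1
  | cat_s0alpha, _ => cat_alpha
  | cat_s1alpha, 0 => cat_pt1
  | cat_s1alpha, _ => cat_alpha
  | cat_tau, _ => cat_alpha
  | cat_eps, 1 => cat_alpha
  | cat_eps, _ => cat_pt1
  end.

Definition catalan_degen0 (i : 'I_1) (x : unit) : catalan1 := cat_pt1.

Definition catalan_degen1 (i : 'I_2) (x : catalan1) : catalan2 :=
  match x, val i with
  | cat_pt1, _ => cat_pt2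
  | cat_alpha, 0 => cat_s0alpha
  | cat_alpha, _ => cat_s1alpha
  end.

Lemma catalan_dd : dd_ax catalan_face1 catalan_face2.
Proof. by []. Qed.

Lemma catalan_ss : ss_ax catalan_degen0 catalan_degen1.
Proof. by []. Qed.

Lemma catalan_ds_eq0 : ds_eq_ax catalan_face1 catalan_degen0.
Proof. by move=> j []. Qed.

Lemma catalan_ds_eq1 : ds_eq_ax catalan_face2 catalan_degen1.
Proof. by move=> [[|[|//]] ?] []. Qed.

Lemma catalan_ds : ds_ax catalan_face1 catalan_face2 catalan_degen0 catalan_degen1.
Proof. by move=> [[|[|//]] ?] [[|//] ?] []. Qed.

(** The 3-simplices are already generated coskeletally. *)
Definition catalan_trunc : trunc3 0 :=
  Trunc3 catalan_dd (@bdd _ _ _ catalan_face2) catalan_ss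
    (bss catalan_dd catalan_ss catalan_ds_eq1 catalan_ds)
    catalan_ds_eq0 catalan_ds_eq1
    (bds_eq catalan_dd catalan_ds_eq1 catalan_ds)
    catalan_ds (bds catalan_dd catalan_ds_eq1 catalan_ds).

Definition catalan : sset := coskeletal catalan_trunc.

Lemma catalan_filler (w : boundary (@face catalan 1)) :
  exists! x : catalan 3, forall i, face i x = bface i w.
Proof. by exists w; split=> // x wx; apply: boundary_eq => i; rewrite -wx. Qed.

(** * Morphisms 1f between threefold products

    Threefold products are bracketed to the left throughout: a product f1 in the
    usual notation is [f ⊠ 1_C], whereas a product 1f requires associators. *)

(** 1f for a morphism f into a twofold product; otherwise [wlm] is used. *)
HB.lock Definition wl (M : monoidal_category) (A B C B' C' : M)
    (f : hom (B ⊗ C) (B' ⊗ C')) : hom ((A ⊗ B) ⊗ C) ((A ⊗ B') ⊗ C') :=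
  assocV A B' C' ∘ (1_A ⊠ f) ∘ assoc A B C.

HB.lock Definition wlm (M : monoidal_category) (A B C D : M)
    (f : hom (B ⊗ C) D) : hom ((A ⊗ B) ⊗ C) (A ⊗ D) :=
  (1_A ⊠ f) ∘ assoc A B C.

Arguments wl {M} A {B C B' C'} f.
Arguments wlm {M} A {B C D} f.

Section WhiskeringTheory.
Variable M : monoidal_category.
Implicit Types A B C D : M.

Lemma wl1 A B C : wl A 1_(B ⊗ C) = 1_((A ⊗ B) ⊗ C).
Proof. by rewrite wl.unlock tensm1 compm1 assocK. Qed.

Lemma wl_comp A B C B' C' B'' C'' (g : hom (B' ⊗ C') (B'' ⊗ C''))
  (f : hom (B ⊗ C) (B' ⊗ C')) : wl A g ∘ wl A f = wl A (g ∘ f).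
Proof.
rewrite wl.unlock -!compA (compA (assoc _ _ _)) assocVK comp1m tens_compl.
by rewrite !compA.
Qed.

Lemma wlm_wl A B C B' C' D (g : hom (B' ⊗ C') D)
  (f : hom (B ⊗ C) (B' ⊗ C')) : wlm A g ∘ wl A f = wlm A (g ∘ f).
Proof.
rewrite !(wl.unlock, wlm.unlock) -!compA (compA (assoc _ _ _)) assocVK comp1m.
by rewrite compA -tens_compl.
Qed.

Lemma wlm_lunit A C : wlm A (lunit C) = runit A ⊠ 1_C.
Proof. by rewrite wlm.unlock triangle. Qed.

Lemma wlm_runit A B : wlm A (runit B) = runit (A ⊗ B).
Proof. by rewrite wlm.unlock runit_tens. Qed.

Lemma lunit_wl B C B' C' (f : hom (B ⊗ C) (B' ⊗ C')) :
  (lunit B' ⊠ 1_C') ∘ wl 𝟙 f = f ∘ (lunit B ⊠ 1_C).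
Proof.
by rewrite -!lunit_tens wl.unlock !compA -(compA (lunit _)) assocVK compm1 lunit_nat.
Qed.

Lemma lunit_wlm B C D (f : hom (B ⊗ C) D) :
  lunit D ∘ wlm 𝟙 f = f ∘ (lunit B ⊠ 1_C).
Proof. by rewrite -lunit_tens wlm.unlock !compA lunit_nat. Qed.

Lemma runit_wl_lunit A B C C' (f : hom (B ⊗ C) (𝟙 ⊗ C')) :
  (runit A ⊠ 1_C') ∘ wl A f = wlm A (lunit C' ∘ f).
Proof. by rewrite -wlm_lunit wlm_wl. Qed.

Lemma runit_wl A B C B' (f : hom (B ⊗ C) (B' ⊗ 𝟙)) :
  runit (A ⊗ B') ∘ wl A f = wlm A (runit B' ∘ f).
Proof. by rewrite -wlm_runit wlm_wl. Qed.

End WhiskeringTheory.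

Section Semigroups.
Variable M : monoidal_category.

Record semigroup := Semigroup {
  sg_ob :> M;
  mul : hom (sg_ob ⊗ sg_ob) sg_ob;
  mulA : mul ∘ (mul ⊠ 1_sg_ob) = mul ∘ wlm sg_ob mul }.

Lemma unit_mulA : lunit 𝟙 ∘ (lunit 𝟙 ⊠ 1_𝟙) = lunit 𝟙 ∘ wlm 𝟙 (lunit 𝟙) :> hom _ (𝟙 : M).
Proof. by rewrite wlm_lunit lunitI. Qed.

Definition unit_sg : semigroup := Semigroup unit_mulA.

End Semigroups.

Section MultiplierBimonoids.
Variable M : braided_category.
Implicit Type A : M.

(** [fusion_rev] and [fusion_rev_counit] are the notions of fusion morphism and counit
    in the reverse braided category (reversed tensor product, same braiding),
    written in terms of [M].  The target of a counit equation (1e).t = 1e is taken to be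
    [A ⊗ 𝟙] rather than [A]. *)
Definition fusion A (t : hom (A ⊗ A) (A ⊗ A)) : Prop :=
  wl A t ∘ (t ⊠ 1_A)
  = (t ⊠ 1_A) ∘ (braidV A A ⊠ 1_A) ∘ wl A t ∘ (braid A A ⊠ 1_A) ∘ wl A t.

Definition fusion_counit A (t : hom (A ⊗ A) (A ⊗ A)) (e : hom A 𝟙) : Prop :=
  (1_A ⊠ e) ∘ t = 1_A ⊠ e.

Definition fusion_rev A (t : hom (A ⊗ A) (A ⊗ A)) : Prop :=
  (t ⊠ 1_A) ∘ wl A t
  = wl A t ∘ wl A (braidV A A) ∘ (t ⊠ 1_A) ∘ wl A (braid A A) ∘ (t ⊠ 1_A).

Definition fusion_rev_counit A (t : hom (A ⊗ A) (A ⊗ A)) (e : hom A 𝟙) : Prop :=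
  (e ⊠ 1_A) ∘ t = e ⊠ 1_A.

Record multiplier_bimonoid := MultiplierBimonoid {
  mb_ob :> M;
  mb_t1 : hom (mb_ob ⊗ mb_ob) (mb_ob ⊗ mb_ob);
  mb_t2 : hom (mb_ob ⊗ mb_ob) (mb_ob ⊗ mb_ob);
  mb_e : hom mb_ob 𝟙;
  mb_fusion1 : fusion mb_t1;
  mb_fusion2 : fusion_rev mb_t2;
  mb_counit1 : fusion_counit mb_t1 mb_e;
  mb_counit2 : fusion_rev_counit mb_t2 mb_e;
  mb_comm : wl mb_ob mb_t1 ∘ (mb_t2 ⊠ 1_mb_ob) = (mb_t2 ⊠ 1_mb_ob) ∘ wl mb_ob mb_t1;
  mb_mul : runit mb_ob ∘ (1_mb_ob ⊠ mb_e) ∘ mb_t2 = lunit mb_ob ∘ (mb_e ⊠ 1_mb_ob) ∘ mb_t1 }.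

End MultiplierBimonoids.

Section M12.
Variable M : braided_category.

(** * The simplicial set M12

    A 2-simplex of M12 is a pair of a 2-simplex [phi] of M1 and a 2-simplex [psi]
    of M2; the semigroup [Aij] is the edge from vertex i to vertex j, so that
    d_0, d_1, d_2 are [A12], [A02], [A01]. *)
Definition M1_2simplex (A12 A02 A01 : semigroup M)
    (phi : hom (A02 ⊗ A12) (A01 ⊗ A12)) : Prop :=
  phi ∘ wlm A02 (mul A12) = wlm A01 (mul A12) ∘ (phi ⊠ 1_A12) /\
  phi ∘ (mul A02 ⊠ 1_A12)
  = (mul A01 ⊠ 1_A12) ∘ (braidV A01 A01 ⊠ 1_A12) ∘ wl A01 phi
      ∘ (braid A02 A01 ⊠ 1_A12) ∘ wl A02 phi.

Definition M2_2simplex (A12 A02 A01 : semigroup M)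
    (psi : hom (A01 ⊗ A02) (A01 ⊗ A12)) : Prop :=
  psi ∘ (mul A01 ⊠ 1_A02) = (mul A01 ⊠ 1_A12) ∘ wl A01 psi /\
  psi ∘ wlm A01 (mul A02)
  = wlm A01 (mul A12) ∘ wl A01 (braidV A12 A12) ∘ (psi ⊠ 1_A12)
      ∘ wl A01 (braid A12 A02) ∘ (psi ⊠ 1_A02).

Record M12_pair (A12 A02 A01 : semigroup M) := M12Pair {
  phi : hom (A02 ⊗ A12) (A01 ⊗ A12);
  psi : hom (A01 ⊗ A02) (A01 ⊗ A12);
  phiP : M1_2simplex phi;
  psiP : M2_2simplex psi;
  phi_psiP : (mul A01 ⊠ 1_A12) ∘ wl A01 phi = wlm A01 (mul A12) ∘ (psi ⊠ 1_A12) }.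

Lemma M12_pair_eq (A12 A02 A01 : semigroup M) (w w' : M12_pair A12 A02 A01) :
  phi w = phi w' -> psi w = psi w' -> w = w'.
Proof.
case: w w' => [f g p q r] [f' g' p' q' r'] /= e e'.
case: _ / e in p' r' *; case: _ / e' in q' r' *.
by congr M12Pair; apply: Prop_irrelevance.
Qed.

Record M12_2simplex := M12Simplex2 {
  edge12 : semigroup M; edge02 : semigroup M; edge01 : semigroup M;
  M12_2val : M12_pair edge12 edge02 edge01 }.

Definition M1_filler (A23 A13 A12 A03 A02 A01 : semigroup M)
    (phi123 : hom (A13 ⊗ A23) (A12 ⊗ A23)) (phi023 : hom (A03 ⊗ A23) (A02 ⊗ A23))
    (phi013 : hom (A03 ⊗ A13) (A01 ⊗ A13)) (phi012 : hom (A02 ⊗ A12) (A01 ⊗ A12)) :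
    Prop :=
  wl A01 phi123 ∘ (phi013 ⊠ 1_A23)
  = (phi012 ⊠ 1_A23) ∘ (braidV A02 A12 ⊠ 1_A23) ∘ wl A12 phi023
      ∘ (braid A03 A12 ⊠ 1_A23) ∘ wl A03 phi123.

Definition M2_filler (A23 A13 A12 A03 A02 A01 : semigroup M)
    (psi123 : hom (A12 ⊗ A13) (A12 ⊗ A23)) (psi023 : hom (A02 ⊗ A03) (A02 ⊗ A23))
    (psi013 : hom (A01 ⊗ A03) (A01 ⊗ A13)) (psi012 : hom (A01 ⊗ A02) (A01 ⊗ A12)) :
    Prop :=
  (psi012 ⊠ 1_A23) ∘ wl A01 psi023
  = wl A01 psi123 ∘ wl A01 (braidV A12 A13) ∘ (psi013 ⊠ 1_A12)
      ∘ wl A01 (braid A12 A03) ∘ (psi012 ⊠ 1_A03).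

Definition M12_filler (A23 A13 A12 A03 A02 A01 : semigroup M)
    (w123 : M12_pair A23 A13 A12) (w023 : M12_pair A23 A03 A02)
    (w013 : M12_pair A13 A03 A01) (w012 : M12_pair A12 A02 A01) : Prop :=
  [/\ M1_filler (phi w123) (phi w023) (phi w013) (phi w012),
      M2_filler (psi w123) (psi w023) (psi w013) (psi w012)
    & (psi w012 ⊠ 1_A23) ∘ wl A01 (phi w023)
      = wl A01 (phi w123) ∘ (psi w013 ⊠ 1_A23)].

Record M12_3simplex := M12Simplex3 {
  edge3_23 : semigroup M; edge3_13 : semigroup M; edge3_12 : semigroup M;
  edge3_03 : semigroup M; edge3_02 : semigroup M; edge3_01 : semigroup M;
  face3_123 : M12_pair edge3_23 edge3_13 edge3_12;
  face3_023 : M12_pair edge3_23 edge3_03 edge3_02;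
  face3_013 : M12_pair edge3_13 edge3_03 edge3_01;
  face3_012 : M12_pair edge3_12 edge3_02 edge3_01;
  M12_3P : M12_filler face3_123 face3_023 face3_013 face3_012 }.

Lemma M12_3simplex_eq (A23 A13 A12 A03 A02 A01 : semigroup M)
    (w123 w123' : M12_pair A23 A13 A12) (w023 w023' : M12_pair A23 A03 A02)
    (w013 w013' : M12_pair A13 A03 A01) (w012 w012' : M12_pair A12 A02 A01) p p' :
  w123 = w123' -> w023 = w023' -> w013 = w013' -> w012 = w012' ->
  @M12Simplex3 A23 A13 A12 A03 A02 A01 w123 w023 w013 w012 p
  = @M12Simplex3 A23 A13 A12 A03 A02 A01 w123' w023' w013' w012' p'.
Proof.
move=> e1 e2 e3 e4; case: _ / e1 in p' *; case: _ / e2 in p' *.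
case: _ / e3 in p' *; case: _ / e4 in p' *.
by congr M12Simplex3; apply: Prop_irrelevance.
Qed.

Definition M12_face1 (i : 'I_2) (A : semigroup M) : unit := tt.

Definition M12_face2 (i : 'I_3) (w : M12_2simplex) : semigroup M :=
  match val i with 0 => edge12 w | 1 => edge02 w | _ => edge01 w end.

Definition M12_face3 (i : 'I_4) (w : M12_3simplex) : M12_2simplex :=
  match val i with
  | 0 => M12Simplex2 (face3_123 w)
  | 1 => M12Simplex2 (face3_023 w)
  | 2 => M12Simplex2 (face3_013 w)
  | _ => M12Simplex2 (face3_012 w)
  end.

Definition M12_degen0 (i : 'I_1) (x : unit) : semigroup M := unit_sg M.

Lemma lunit_braidV (B : M) : lunit B ∘ braidV 𝟙 B = runit B.
Proof. by rewrite -runit_braid -compA braidVK compm1. Qed.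

Lemma runit_braidV (B : M) : runit B ∘ braidV B 𝟙 = lunit B.
Proof. by rewrite -lunit_braid -compA braidVK compm1. Qed.

Lemma wl_braidK (A B C : M) : wl A (braidV B C) ∘ wl A (braid B C) = 1_((A ⊗ B) ⊗ C).
Proof. by rewrite wl_comp braidK wl1. Qed.

Lemma braidK_wr (A B C : M) :
  (braidV B C ⊠ 1_A) ∘ (braid B C ⊠ 1_A) = 1_((B ⊗ C) ⊗ A).
Proof. by rewrite -tens_compr braidK tensm1. Qed.

Lemma lunit_wr_cancel (A B C : M) (f g : hom A ((𝟙 ⊗ B) ⊗ C)) :
  (lunit B ⊠ 1_C) ∘ f = (lunit B ⊠ 1_C) ∘ g -> f = g.
Proof.
by apply: (@mon_cancell _ _ _ _ _ (lunitV B ⊠ 1_C)); rewrite -tens_compr lunitK tensm1.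
Qed.

Lemma runit_wr_cancel (A B C : M) (f g : hom A ((B ⊗ 𝟙) ⊗ C)) :
  (runit B ⊠ 1_C) ∘ f = (runit B ⊠ 1_C) ∘ g -> f = g.
Proof.
by apply: (@mon_cancell _ _ _ _ _ (runitV B ⊠ 1_C)); rewrite -tens_compr runitK tensm1.
Qed.

(** The degenerate 2-simplices s_0(A) = (m | 1) and s_1(A) = (1 | m), up to the
    unit isomorphisms. *)
Lemma deg0_phiP (A : semigroup M) :
  @M1_2simplex A A (unit_sg M) (lunitV A ∘ mul A).
Proof.
split; apply: (mon_cancell (lunitK A)); rewrite /= !compA lunitVK comp1m.
- by rewrite lunit_wlm -compA -tens_compr compA lunitVK comp1m mulA.
rewrite -(compA (lunit A)) -tens_compr lunit_braidV -lunitI.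
rewrite -(compA (lunit A)) lunit_wl !compA lunitVK comp1m.
rewrite -(compA (mul A)) -tens_compr lunit_braid.
by rewrite -(compA (mul A)) runit_wl_lunit compA lunitVK comp1m mulA.
Qed.

Lemma deg0_psiP (A : semigroup M) :
  @M2_2simplex A A (unit_sg M) 1_(unit_sg M ⊗ A).
Proof.
split; first by rewrite wl1 comp1m compm1.
by rewrite tensm1 comp1m !compm1 -compA wl_braidK compm1.
Qed.

Lemma deg0_phi_psiP (A : semigroup M) :
  (mul (unit_sg M) ⊠ 1_A) ∘ wl 𝟙 (lunitV A ∘ mul A)
  = wlm 𝟙 (mul A) ∘ (1_(𝟙 ⊗ A) ⊠ 1_A).
Proof.
rewrite /= tensm1 compm1 lunit_wl; apply: (mon_cancell (lunitK A)).
by rewrite !compA lunitVK comp1m lunit_wlm.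
Qed.

Definition deg0 (A : semigroup M) : M12_pair A A (unit_sg M) :=
  M12Pair (deg0_phiP A) (deg0_psiP A) (deg0_phi_psiP A).

Lemma deg1_phiP (A : semigroup M) :
  @M1_2simplex (unit_sg M) A A 1_(A ⊗ unit_sg M).
Proof.
split; first by rewrite tensm1 comp1m compm1.
by rewrite !wl1 comp1m !compm1 -compA braidK_wr compm1.
Qed.

Lemma deg1_psiP (A : semigroup M) :
  @M2_2simplex (unit_sg M) A A (runitV A ∘ mul A).
Proof.
split; apply: (mon_cancell (runitK A)); rewrite /= !compA runitVK comp1m.
- rewrite runit_nat -wlm_runit -(compA _ (wlm _ _)) wlm_wl compA runitVK comp1m.
  exact: mulA.
rewrite -(compA (runit A)) wlm_wl lunit_braidV wlm_runit.
rewrite -(compA (runit A)) runit_nat !compA runitVK comp1m.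
rewrite -(compA (mul A)) -wlm_runit wlm_wl runit_braid wlm_lunit.
by rewrite -compA -tens_compr compA runitVK comp1m mulA.
Qed.

Lemma deg1_phi_psiP (A : semigroup M) :
  (mul A ⊠ 1_𝟙) ∘ wl A 1_(A ⊗ 𝟙)
  = wlm A (mul (unit_sg M)) ∘ ((runitV A ∘ mul A) ⊠ 1_𝟙).
Proof.
by rewrite wl1 compm1 wlm_lunit -tens_compr compA runitVK comp1m.
Qed.

Definition deg1 (A : semigroup M) : M12_pair (unit_sg M) A A :=
  M12Pair (deg1_phiP A) (deg1_psiP A) (deg1_phi_psiP A).

Definition M12_degen1 (i : 'I_2) (A : semigroup M) : M12_2simplex :=
  match val i with 0 => M12Simplex2 (deg0 A) | _ => M12Simplex2 (deg1 A) end.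

Section Degen2.
Variables (A12 A02 A01 : semigroup M) (w : M12_pair A12 A02 A01).

Lemma deg20_P : M12_filler w w (deg0 A02) (deg0 A01).
Proof.
split; rewrite /M1_filler /M2_filler /=.
- apply: lunit_wr_cancel; rewrite !compA lunit_wl -compA -!tens_compr !compA.
  by rewrite !lunitVK !comp1m tens_compr; case: (phiP w).
- by rewrite !tensm1 !comp1m !compm1 -compA wl_braidK compm1.
- by rewrite !tensm1 comp1m compm1.
Qed.

Lemma deg21_P : M12_filler (deg0 A12) w w (deg1 A01).
Proof.
split; rewrite /M1_filler /M2_filler /=.
- apply: runit_wr_cancel; rewrite !compA runit_wl_lunit compA lunitVK comp1m.
  rewrite tensm1 compm1 -tens_compr runit_braidV lunit_wl.
  rewrite -(compA (phi w)) -tens_compr lunit_braid -compA runit_wl_lunit.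
  by rewrite compA lunitVK comp1m; case: (phiP w).
- apply: runit_wr_cancel; rewrite wl1 comp1m !compA -tens_compr compA runitVK comp1m.
  rewrite runit_wl_lunit lunit_braidV wlm_runit runit_nat -wlm_runit.
  rewrite -(compA (psi w)) wlm_wl runit_braid wlm_lunit -compA -tens_compr compA.
  by rewrite runitVK comp1m; case: (psiP w).
- apply: runit_wr_cancel; rewrite !compA -tens_compr compA runitVK comp1m.
  by rewrite runit_wl_lunit compA lunitVK comp1m; exact: phi_psiP.
Qed.

Lemma deg22_P : M12_filler (deg1 A12) (deg1 A02) w w.
Proof.
split; rewrite /M1_filler /M2_filler /=.
- by rewrite !wl1 comp1m !compm1 -compA braidK_wr compm1.
- apply: (mon_cancell (runitK (A01 ⊗ A12))); rewrite !compA runit_nat.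
  rewrite -(compA (psi w)) !runit_wl !compA !runitVK !comp1m.
  by case: (psiP w) => _ ->; rewrite wlm_wl.
- by rewrite !wl1 comp1m compm1.
Qed.

End Degen2.

Definition M12_degen2 (i : 'I_3) (w : M12_2simplex) : M12_3simplex :=
  match val i with
  | 0 => M12Simplex3 (deg20_P (M12_2val w))
  | 1 => M12Simplex3 (deg21_P (M12_2val w))
  | _ => M12Simplex3 (deg22_P (M12_2val w))
  end.

Lemma deg01_unit : deg0 (unit_sg M) = deg1 (unit_sg M).
Proof. by apply: M12_pair_eq; rewrite /= ?lunitK // lunitI runitK. Qed.

Lemma M12_dd1 : dd_ax M12_face1 M12_face2.
Proof. by []. Qed.

Lemma M12_dd2 : dd_ax M12_face2 M12_face3.
Proof. by move=> [[|[|[|//]]] ?] [[|[|[|//]]] ?]. Qed.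

Lemma M12_ss0 : ss_ax M12_degen0 M12_degen1.
Proof.
move=> [[|//] ?] [[|//] ?] x _.
by rewrite /M12_degen1 /= /M12_degen0 deg01_unit.
Qed.

Lemma M12_ss1 : ss_ax M12_degen1 M12_degen2.
Proof.
by move=> [[|[|//]] ?] [[|[|//]] ?] A //= _; apply: M12_3simplex_eq;
  rewrite ?deg01_unit.
Qed.

Lemma M12_ds_eq0 : ds_eq_ax M12_face1 M12_degen0.
Proof. by move=> j []. Qed.

Lemma M12_ds_eq1 : ds_eq_ax M12_face2 M12_degen1.
Proof. by move=> [[|[|//]] ?]. Qed.

Lemma M12_ds_eq2 : ds_eq_ax M12_face3 M12_degen2.
Proof. by move=> [[|[|[|//]]] ?] []. Qed.

Lemma M12_ds1 : ds_ax M12_face1 M12_face2 M12_degen0 M12_degen1.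
Proof. by move=> [[|[|//]] ?] [[|//] ?] A. Qed.

Lemma M12_ds2 : ds_ax M12_face2 M12_face3 M12_degen1 M12_degen2.
Proof. by move=> [[|[|[|//]]] ?] [[|[|//]] ?] w. Qed.

Definition M12_trunc : trunc3 0 :=
  Trunc3 M12_dd1 M12_dd2 M12_ss0 M12_ss1 M12_ds_eq0 M12_ds_eq1 M12_ds_eq2
    M12_ds1 M12_ds2.

Definition M12 : sset := coskeletal M12_trunc.

End M12.

(* Main.v *)
Require Import Defs.
From mathcomp Require Import all_boot zify.
From mathcomp Require Import boolp.
From Stdlib Require Import Eqdep.
Import Defs.
Set Implicit Arguments.
Unset Strict Implicit.
Unset Printing Implicit Defensive.
Local Open Scope moncat_scope.

(** Both sides of the bijection amount to the same finite data [catalan_data]: a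
    semigroup [A], the image of alpha; a 2-simplex with all three edges [A], the image
    (t1 | t2) of tau; a 2-simplex with edges I, A, I, the image of epsilon; and fillers
    for three boundaries of 3-simplices.

    On the simplicial side, everything above dimension 3 is coskeletal, and a 3-simplex
    of M12 is determined by its faces ([M12_face3_separated]).  So a simplicial map out of
    the Catalan simplicial set is determined by what it does in dimensions at most 2
    ([smap_coskeletal_eq]), and conversely a map in dimensions at most 3 extends
    ([coskeletal_map]), where compatibility with the new degeneracies is automatic because
    a degenerate simplex is pinned down by its faces ([degen_transfer]).  What remains is
    to fill the images of the Catalan 3-simplices.  A Catalan simplex is determined by its
    edges, the admissible edge assignments being those where an edge spanning a
    nondegenerate edge is nondegenerate, so there are 14 simplices of dimension 3.  Ten of
    them are degenerate.  Of the other four, (epsilon, s_1 alpha, s_0 alpha, epsilon) has a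
    filler for every choice of the data ([filler_k]), because its condition says that the
    counit is multiplicative, which is already part of the image of epsilon being a
    2-simplex.  The remaining three are the fillers recorded in [catalan_data].

    On the algebraic side, the filler for (tau, tau, tau, tau) consists by definition of the
    two fusion equations and of the compatibility of t1 with t2.  The image of epsilon is a
    single morphism e : A -> I that is multiplicative ([phi_counit], [psi_counit]).  The
    other two fillers say that e is a counit of t1 and of t2, and that the multiplication
    is m = (1e).t2 = (e1).t1 ([filler_l], [filler_r]).  So the data determine a multiplier
    bimonoid, and the multiplication of the semigroup carries no further information.
    Conversely, given a multiplier bimonoid one defines m = (e1).t1 = (1e).t2, and all the
    identities that involve m (associativity, the 2-simplex conditions for t1 and t2, the
    multiplicativity of e) come from applying e to one tensor factor of a fusion equation or
    of the compatibility of t1 with t2: the counit law and the naturality of the braiding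
    then absorb all but one of the copies of t on one side. *)

(** * Maps into coskeletal simplicial sets *)

(** For the 3-simplices of M12 this is the uniqueness of fillers, which is all that
    remains of coskeletality there: not every boundary has a filler. *)
Definition separated n (X0 X1 : Type) (d : 'I_n.+2 -> X1 -> X0) : Prop :=
  forall x y : X1, (forall i, d i x = d i y) -> x = y.

Lemma bface_separated n (X0 X1 : Type) (d : 'I_n.+2 -> X1 -> X0) :
  separated (@bface n X0 X1 d).
Proof. exact: boundary_eq. Qed.

(** The case split behind the simplicial identities for d_k s_j, in the form in which
    [ds_eq_ax] and [ds_ax] can be rewritten with. *)
Lemma face_degen_cases n (k : 'I_n.+3) (j : 'I_n.+2) :
  [\/ k = ordwid j, k = ordup j,
      exists (i : 'I_n.+2) (j' : 'I_n.+1), [/\ k = ordwid i, j = ordup j' & i <= j']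
    | exists (i : 'I_n.+2) (j' : 'I_n.+1), [/\ k = ordup i, j = ordwid j' & j' < i]].
Proof.
have lj := ltn_ord j; have lk := ltn_ord k.
case: (ltngtP k j) => [kj|jk|kj]; last by constructor 1; apply: val_inj.
  have ki : (inord k : 'I_n.+2) = k :> nat by rewrite inordK //; lia.
  have ji : (inord j.-1 : 'I_n.+1) = j.-1 :> nat by rewrite inordK //; lia.
  constructor 3; exists (inord k), (inord j.-1).
  by split; [apply: val_inj| apply: val_inj|]; rewrite /= ?/bump ?ki ?ji //=; lia.
case: (eqVneq (val k) j.+1) => [kj|kj]; first by constructor 2; apply: val_inj.
have ki : (inord k.-1 : 'I_n.+2) = k.-1 :> nat by rewrite inordK //; lia.
have ji : (inord j : 'I_n.+1) = j :> nat.
  by rewrite inordK //; move: kj => /=; lia.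
constructor 4; exists (inord k.-1), (inord j).
split; [apply: val_inj| apply: val_inj|]; rewrite /= ?/bump ?ki ?ji //=.
  by lia.
by move: kj => /=; lia.
Qed.

Section DegeneracyTransfer.
Variables (n : nat) (X0 X1 X2 Y0 Y1 Y2 : Type).
Variables (d1 : 'I_n.+2 -> X1 -> X0) (d2 : 'I_n.+3 -> X2 -> X1).
Variables (s0 : 'I_n.+1 -> X0 -> X1) (s1 : 'I_n.+2 -> X1 -> X2).
Variables (d1' : 'I_n.+2 -> Y1 -> Y0) (d2' : 'I_n.+3 -> Y2 -> Y1).
Variables (s0' : 'I_n.+1 -> Y0 -> Y1) (s1' : 'I_n.+2 -> Y1 -> Y2).
Variables (f0 : X0 -> Y0) (f1 : X1 -> Y1) (f2 : X2 -> Y2).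
Hypotheses (ds_eq : ds_eq_ax d2 s1) (ds : ds_ax d1 d2 s0 s1).
Hypotheses (ds_eq' : ds_eq_ax d2' s1') (ds' : ds_ax d1' d2' s0' s1').
Hypotheses (f1d : forall i x, f0 (d1 i x) = d1' i (f1 x)).
Hypotheses (f2d : forall i x, f1 (d2 i x) = d2' i (f2 x)).
Hypotheses (f1s : forall i x, f1 (s0 i x) = s0' i (f0 x)).

(** By the simplicial identities, each face of s_j(x) is x or a degeneracy of a face of
    x, and the maps in lower dimensions respect these; a separated target has no room for
    two simplices with the same faces. *)
Lemma degen_transfer : separated d2' ->
  forall i x, f2 (s1 i x) = s1' i (f1 x).
Proof.
move=> sep j x; apply: sep => k; rewrite -f2d.
have [->|->|[i [j' [-> -> ij]]]|[i [j' [-> -> ij]]]] := face_degen_cases k j.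
- by rewrite (ds_eq _ _).1 (ds_eq' _ _).1.
- by rewrite (ds_eq _ _).2 (ds_eq' _ _).2.
- by rewrite (ds _ _ _).1 // (ds' _ _ _).1 // f1s f1d.
- by rewrite (ds _ _ _).2 // (ds' _ _ _).2 // f1s f1d.
Qed.

End DegeneracyTransfer.

Record trunc3_map n (T T' : trunc3 n) := Trunc3Map {
  tmap0 : tlevel0 T -> tlevel0 T';
  tmap1 : tlevel1 T -> tlevel1 T';
  tmap2 : tlevel2 T -> tlevel2 T';
  tmap3 : tlevel3 T -> tlevel3 T';
  tmap_face1 : forall i x, tmap0 (tface1 i x) = tface1 i (tmap1 x);
  tmap_face2 : forall i x, tmap1 (tface2 i x) = tface2 i (tmap2 x);
  tmap_face3 : forall i x, tmap2 (tface3 i x) = tface3 i (tmap3 x);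
  tmap_degen0 : forall i x, tmap1 (tdegen0 i x) = tdegen0 i (tmap0 x);
  tmap_degen1 : forall i x, tmap2 (tdegen1 i x) = tdegen1 i (tmap1 x);
  tmap_degen2 : forall i x, tmap3 (tdegen2 i x) = tdegen2 i (tmap2 x) }.

Section NextMap.
Variables (n : nat) (T T' : trunc3 n) (f : trunc3_map T T').

Definition boundary_map (w : boundary (@tface3 n T)) : boundary (@tface3 n T').
Proof.
exists (fun i => tmap3 f (sval w i)) => i j ij.
by rewrite -!tmap_face3 (svalP w).
Defined.

(** Given by transparent terms, as are the definitions built on it: the values of the
    resulting simplicial maps in dimensions at most 3 then hold by computation. *)
Definition trunc3_map_next : trunc3_map (trunc3_next T) (trunc3_next T').
Proof.
apply: (@Trunc3Map _ (trunc3_next T) (trunc3_next T') (tmap1 f) (tmap2 f) (tmap3 f)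
  boundary_map (@tmap_face2 _ _ _ f) (@tmap_face3 _ _ _ f) _
  (@tmap_degen1 _ _ _ f) (@tmap_degen2 _ _ _ f)) => //.
apply: (@degen_transfer n.+2 _ _ _ _ _ _ (@tface3 n T) (@bface _ _ _ (@tface3 n T))
  (@tdegen2 n T) _ (@tface3 n T')
  (@bface _ _ _ (@tface3 n T')) (@tdegen2 n T') _ (tmap2 f) (tmap3 f)).
- exact: (t_ds_eq2 (t := trunc3_next T)).
- exact: (t_ds2 (t := trunc3_next T)).
- exact: (t_ds_eq2 (t := trunc3_next T')).
- exact: (t_ds2 (t := trunc3_next T')).
- exact: tmap_face3.
- by [].
- exact: tmap_degen2.
- exact: bface_separated.
Defined.

End NextMap.

Fixpoint cosk_stage_map (T T' : trunc3 0) (f : trunc3_map T T') n :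
    trunc3_map (cosk_stage T n) (cosk_stage T' n) :=
  if n is n'.+1 then trunc3_map_next (cosk_stage_map f n') else f.

Definition coskeletal_map (T T' : trunc3 0) (f : trunc3_map T T') :
    smap (coskeletal T) (coskeletal T') :=
  @SMap (coskeletal T) (coskeletal T') (fun n => tmap0 (cosk_stage_map f n))
    (fun n => @tmap_face1 _ _ _ (cosk_stage_map f n))
    (fun n => @tmap_degen0 _ _ _ (cosk_stage_map f n)).

Lemma smap_eq (X Y : sset) (F G : smap X Y) : (forall n x, F n x = G n x) -> F = G.
Proof.
case: F G => [F p q] [G p' q'] /= e.
have {}e : F = G by apply: functional_extensionality_dep => n; apply: funext => x; exact: e.
by case: _ / e in p' q' *; congr SMap; apply: Prop_irrelevance.
Qed.

(** From dimension 3 on, simplices of the target are determined by their faces, so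
    agreement propagates upwards. *)
Lemma smap_coskeletal_eq (X : sset) (T : trunc3 0) (F G : smap X (coskeletal T)) :
  separated (@tface3 0 T) ->
  (forall x, F 0 x = G 0 x) -> (forall x, F 1 x = G 1 x) ->
  (forall x, F 2 x = G 2 x) -> F = G.
Proof.
move=> sep e0 e1 e2; apply: smap_eq; case=> [|[|n]] //.
elim: n => [|n IHn] x //.
have {}sep : separated (@face (coskeletal T) n.+2).
  by case: n {IHn x} => [|n] //; exact: bface_separated.
by apply: sep => i; rewrite -!smap_face IHn.
Qed.

(** * Discarding a tensor factor along a morphism to the unit *)

Section Augmentation.
Variable M : braided_category.
Variables (A : M) (e : hom A 𝟙).
Implicit Types B C D X Y : M.

(** [augl] and [augr] are e1 and 1e with the unit isomorphism built in.  In this form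
    they pass through 1f and through the braiding without leaving unitors behind. *)
Definition augl X : hom (A ⊗ X) X := lunit X ∘ (e ⊠ 1_X).
Definition augr X : hom (X ⊗ A) X := runit X ∘ (1_X ⊠ e).

Lemma augl_nat X Y (f : hom X Y) : augl Y ∘ (1_A ⊠ f) = f ∘ augl X.
Proof. by rewrite /augl -compA -mon_interchange compA lunit_nat compA. Qed.

Lemma augr_nat X Y (f : hom X Y) : augr Y ∘ (f ⊠ 1_A) = f ∘ augr X.
Proof. by rewrite /augr -compA mon_interchange compA runit_nat compA. Qed.

Lemma wl_nat B B' C D C' D' (b : hom B B') (f : hom (C ⊗ D) (C' ⊗ D')) :
  wl B' f ∘ ((b ⊠ 1_C) ⊠ 1_D) = ((b ⊠ 1_C') ⊠ 1_D') ∘ wl B f.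
Proof.
rewrite wl.unlock -!compA assoc_nat tensm1 (compA (1_B' ⊠ f)) mon_interchange.
by rewrite !compA -assocV_nat tensm1.
Qed.

Lemma wl_wr B C C' D (f : hom C C') : wl B (f ⊠ 1_D) = (1_B ⊠ f) ⊠ 1_D.
Proof. by rewrite wl.unlock -compA -assoc_nat compA assocK comp1m. Qed.

Lemma wl_wl B C D D' (f : hom D D') : wl B (1_C ⊠ f) = 1_(B ⊗ C) ⊠ f.
Proof. by rewrite wl.unlock -compA -assoc_nat compA assocK comp1m tensm1. Qed.

Lemma augl_wl B C B' C' (f : hom (B ⊗ C) (B' ⊗ C')) :
  (augl B' ⊠ 1_C') ∘ wl A f = f ∘ (augl B ⊠ 1_C).
Proof. by rewrite /augl !tens_compr -compA -wl_nat !compA lunit_wl. Qed.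

Lemma augl_wlm B C D (f : hom (B ⊗ C) D) :
  augl D ∘ wlm A f = f ∘ (augl B ⊠ 1_C).
Proof.
rewrite wlm.unlock compA augl_nat -compA; congr (_ ∘ _).
by rewrite /augl -compA -tensm1 -assoc_nat compA lunit_tens -tens_compr.
Qed.

Lemma wlm_augl B C : wlm B (augl C) = augr B ⊠ 1_C.
Proof. by rewrite /augl /augr -wlm_wl wl_wr wlm_lunit -tens_compr. Qed.

Lemma wlm_augr B C : wlm B (augr C) = augr (B ⊗ C).
Proof. by rewrite /augr -wlm_wl wl_wl wlm_runit. Qed.

(** In a threefold product [B ⊗ A ⊗ E], discarding the middle factor can be read as
    (1e)1 or as 1(e1). *)
Lemma augr_wl_mid B C D E (f : hom (C ⊗ D) (A ⊗ E)) :
  (augr B ⊠ 1_E) ∘ wl B f = wlm B (augl E ∘ f).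
Proof. by rewrite -wlm_augl wlm_wl. Qed.

Lemma augr_wl B C D E (f : hom (C ⊗ D) (E ⊗ A)) :
  augr (B ⊗ E) ∘ wl B f = wlm B (augr E ∘ f).
Proof. by rewrite -wlm_augr wlm_wl. Qed.

Lemma augl_braid B : augl B ∘ braid B A = augr B.
Proof. by rewrite /augl /augr -compA -braid_nat compA lunit_braid. Qed.

Lemma augr_braid B : augr B ∘ braid A B = augl B.
Proof. by rewrite /augl /augr -compA -braid_nat compA runit_braid. Qed.

Lemma augr_braidV B : augr B ∘ braidV B A = augl B.
Proof. by rewrite -augl_braid -compA braidVK compm1. Qed.

Lemma augl_braidV B : augl B ∘ braidV A B = augr B.
Proof. by rewrite -augr_braid -compA braidVK compm1. Qed.

Lemma aug_aug : e ∘ augl A = e ∘ augr A.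
Proof.
by rewrite -augl_nat -augr_nat /augl /augr -!compA !mon_interchange lunitI.
Qed.

Lemma fusion_counitE (t : hom (A ⊗ A) (A ⊗ A)) :
  fusion_counit t e <-> augr A ∘ t = augr A.
Proof.
split; first by rewrite /augr -compA => ->.
by rewrite /augr -compA; apply: (mon_cancell (runitK A)).
Qed.

Lemma fusion_rev_counitE (t : hom (A ⊗ A) (A ⊗ A)) :
  fusion_rev_counit t e <-> augl A ∘ t = augl A.
Proof.
split; first by rewrite /augl -compA => ->.
by rewrite /augl -compA; apply: (mon_cancell (lunitK A)).
Qed.

(** * The multiplication of a fusion morphism *)

Section FusionMul.
Variable t : hom (A ⊗ A) (A ⊗ A).
Hypotheses (tF : fusion t) (te : augr A ∘ t = augr A).
Let m := augl A ∘ t.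

(** Discard the middle factor in the fusion equation.  On the right-hand side the counit
    law removes the t applied last, the two braidings move the discarded factor through, and
    t.(1m) is left. *)
Lemma fusion_mulr : t ∘ wlm A m = wlm A m ∘ (t ⊠ 1_A).
Proof.
rewrite -[in RHS]augr_wl_mid -compA tF !compA -tens_compr te -tens_compr augr_braidV.
by rewrite augl_wl -(compA t) -tens_compr augl_braid -compA augr_wl_mid.
Qed.

(** Discard the first factor in the fusion equation. *)
Lemma fusion_mull :
  t ∘ (m ⊠ 1_A)
  = (m ⊠ 1_A) ∘ (braidV A A ⊠ 1_A) ∘ wl A t ∘ (braid A A ⊠ 1_A) ∘ wl A t.
Proof. by rewrite /m tens_compr compA -augl_wl -compA tF !compA. Qed.

(** Discard the first factor in [fusion_mulr]. *)
Lemma fusion_mulA : m ∘ (m ⊠ 1_A) = m ∘ wlm A m.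
Proof.
by rewrite {3}/m -compA fusion_mulr compA augl_wlm -compA -tens_compr.
Qed.

Lemma fusion_mul_aug : e ∘ m = e ∘ augr A.
Proof. by rewrite /m compA aug_aug -compA te. Qed.

End FusionMul.

Section FusionRevMul.
Variable t : hom (A ⊗ A) (A ⊗ A).
Hypotheses (tF : fusion_rev t) (te : augl A ∘ t = augl A).
Let m := augr A ∘ t.

(** Discard the middle factor in the reversed fusion equation. *)
Lemma fusion_rev_mull : t ∘ (m ⊠ 1_A) = (m ⊠ 1_A) ∘ wl A t.
Proof.
rewrite [in RHS]/m tens_compr -compA tF !compA augr_wl_mid te wlm_wl augl_braidV.
rewrite wlm_augr augr_nat -[_ ∘ augr _ ∘ wl _ _]compA augr_wl augr_braid wlm_augl -compA.
by rewrite -tens_compr.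
Qed.

(** Discard the last factor in the reversed fusion equation. *)
Lemma fusion_rev_mulr :
  t ∘ wlm A m = wlm A m ∘ wl A (braidV A A) ∘ (t ⊠ 1_A) ∘ wl A (braid A A) ∘ (t ⊠ 1_A).
Proof. by rewrite /m -augr_wl compA -augr_nat -compA tF !compA augr_wl. Qed.

End FusionRevMul.

(** Discard the middle factor in the compatibility of t1 with t2, using each of the two
    descriptions of m once. *)
Lemma fusion_mul_compat (t1 t2 : hom (A ⊗ A) (A ⊗ A)) (m : hom (A ⊗ A) A) :
  m = augl A ∘ t1 -> m = augr A ∘ t2 ->
  wl A t1 ∘ (t2 ⊠ 1_A) = (t2 ⊠ 1_A) ∘ wl A t1 ->
  (m ⊠ 1_A) ∘ wl A t1 = wlm A m ∘ (t2 ⊠ 1_A).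
Proof.
move=> m1 m2 t12.
by rewrite m2 tens_compr -compA -t12 compA augr_wl_mid -m1 m2.
Qed.

End Augmentation.

(** * The image of epsilon and the fillers that involve it *)

Section Fillers.
Variable M : braided_category.
Local Notation I := (unit_sg M).

Lemma tens_unitr (X Y : M) (f : hom (X ⊗ 𝟙) (Y ⊗ 𝟙)) :
  (runit Y ∘ f ∘ runitV X) ⊠ 1_𝟙 = f.
Proof.
apply: (mon_cancell (runitK Y)).
by rewrite runit_nat -[LHS]compA runitK compm1.
Qed.

Lemma wl_unit_faithful (X Y X' Y' : M) (f g : hom (X ⊗ Y) (X' ⊗ Y')) :
  wl 𝟙 f = wl 𝟙 g -> f = g.
Proof.
move=> fg; have e : (lunit X ⊠ 1_Y) ∘ (lunitV X ⊠ 1_Y) = 1_(X ⊗ Y).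
  by rewrite -tens_compr lunitVK tensm1.
by apply: (mon_cancelr e); rewrite -!lunit_wl fg.
Qed.

Lemma tens_wlm (A B C D E : M) (f : hom D E) (g : hom (B ⊗ C) D) :
  (1_A ⊠ f) ∘ wlm A g = wlm A (f ∘ g).
Proof. by rewrite wlm.unlock compA -tens_compl. Qed.

Section CounitPair.
Variables (A : semigroup M) (e : hom A 𝟙).
Hypothesis e_mul : e ∘ mul A = e ∘ augl e A.

(** The second 2-simplex condition of M1 is where multiplicativity is used: with trivial
    outer edges its right-hand side collapses to e tensored with e. *)
Lemma counit_phiP : @M1_2simplex M I A I (e ⊠ 1_𝟙).
Proof.
split=> /=.
  by rewrite !wlm_lunit -!tens_compr runit_nat.
rewrite !wl_wr -!tens_compr e_mul -augl_nat /augl; congr (_ ⊠ _).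
by rewrite -!compA (compA _ (braid _ _)) -braid_nat -!compA (compA (braidV _ _)) braidK comp1m.
Qed.

Lemma counit_psiP : @M2_2simplex M I A I (1_𝟙 ⊠ e).
Proof.
split=> /=; first by rewrite wl_wl mon_interchange.
rewrite -!wl_wr !(wl_comp, wlm_wl) tens_wlm e_mul; congr (wlm _ _).
rewrite -!compA (compA _ (braid _ _)) -braid_nat -!compA (compA (braidV _ _)) braidK comp1m.
by rewrite compA lunit_nat -compA.
Qed.

Lemma counit_phi_psiP :
  (mul I ⊠ 1_𝟙) ∘ wl 𝟙 (e ⊠ 1_𝟙) = wlm 𝟙 (mul I) ∘ ((1_𝟙 ⊠ e) ⊠ 1_𝟙).
Proof. by rewrite wlm_lunit wl_wr /= lunitI. Qed.

Definition counit_pair : M12_pair I A I :=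
  M12Pair counit_phiP counit_psiP counit_phi_psiP.

End CounitPair.

Section Counit.
Variables (A : semigroup M) (eps : M12_pair I A I).

(** The morphism A -> I underlying the first component; [psi_counit] shows that the
    second component has the same one. *)
Definition counit : hom A 𝟙 := runit 𝟙 ∘ phi eps ∘ runitV A.

Lemma phi_counit : phi eps = counit ⊠ 1_𝟙.
Proof. by rewrite tens_unitr. Qed.

(** With both outer edges trivial, the compatibility of the two components of a
    2-simplex of M12 says that they agree up to the unit isomorphisms. *)
Lemma psi_counit : psi eps = 1_𝟙 ⊠ counit.
Proof.
have := phi_psiP eps; rewrite phi_counit wl_wr wlm_lunit /= -lunitI -!tens_compr.
move/runit_faithful => /(mon_cancell (lunitK _)) e; apply: esym.
exact: e.
Qed.

Lemma counit_mul : counit ∘ mul A = counit ∘ augl counit A.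
Proof.
have [_] := phiP eps; rewrite phi_counit !wl_wr -!tens_compr /=.
move/runit_faithful => ->; rewrite -augl_nat /augl.
by rewrite -!compA (compA _ (braid _ _)) -braid_nat -!compA (compA (braidV _ _)) braidK comp1m.
Qed.

(** The conditions of M1 and M2 both reduce to [counit_mul]; the two braidings in each of
    them are inverse to each other. *)
Lemma filler_k : M12_filler eps (deg1 A) (deg0 A) eps.
Proof.
split; rewrite /M1_filler /M2_filler ?phi_counit ?psi_counit /=.
- rewrite !(wl_wr, wl1) compm1 -!tens_compr; congr (_ ⊠ _).
  apply: (mon_cancell (lunitK 𝟙)); rewrite -(compA (counit ⊠ _)) braidK compm1.
  rewrite !compA lunit_nat -(compA _ (lunit A)) lunitVK compm1 counit_mul -augl_nat.
  by rewrite /augl.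
- rewrite -!wl_wr tensm1 compm1 !wl_comp; congr (wl _ _).
  apply: (mon_cancell (runitK 𝟙)); rewrite -(compA (1_𝟙 ⊠ _)) braidK compm1.
  rewrite !compA runit_nat -(compA _ (runit A)) runitVK compm1 counit_mul -augl_nat.
  by rewrite /augl -compA -mon_interchange !compA lunitI.
- by rewrite wl1 tensm1 !compm1 wl_wr.
Qed.

Variable tau : M12_pair A A A.
Local Notation aug_l := (augl counit A).
Local Notation aug_r := (augr counit A).

(** The M1 condition is the counit law for t1, and the mixed condition is m = (1e).t2.
    The M2 condition follows from the latter: with m in place of (1e).t2 it becomes
    associativity of m. *)
Lemma filler_l : M12_filler eps (deg1 A) tau (deg1 A) <->
  aug_r ∘ phi tau = aug_r /\ mul A = aug_r ∘ psi tau.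
Proof.
rewrite /M12_filler /M1_filler /M2_filler phi_counit psi_counit /=; split.
  case=> + _; rewrite !(wl_wr, wl1) tensm1 comp1m !compm1 -!tens_compr braidK comp1m.
  move=> /runit_faithful e1 /runit_faithful e3; split.
    by rewrite /augr -compA e1.
  by rewrite /augr -compA -e3 compA runitVK comp1m.
case=> e1 e2; split.
- rewrite !(wl_wr, wl1) tensm1 comp1m !compm1 -!tens_compr braidK comp1m.
  by congr (_ ⊠ _); apply: (mon_cancell (runitK A)); rewrite compA.
- apply: (mon_cancell (runitK (A ⊗ 𝟙))); rewrite !compA runit_nat.
  rewrite -[LHS]compA runit_wl compA runitVK comp1m.
  rewrite -(compA (runit _)) wl_comp runit_wl compA augr_braidV wlm_augl.
  rewrite -!tens_compr -e2 tens_compr.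
  apply: (mon_cancell (runitK A)); rewrite !compA runitVK comp1m runit_nat.
  rewrite -(compA (mul A)) runit_wl runit_braid wlm_lunit -(compA (mul A)) -tens_compr.
  by rewrite runitVK tensm1 compm1 mulA.
- rewrite wl_wr wl1 compm1 -!tens_compr; congr (_ ⊠ _).
  by apply: (mon_cancell (runitK A)); rewrite !compA runitVK comp1m.
Qed.

(** Dual to [filler_l]: here M1 and M2 exchange roles. *)
Lemma filler_r : M12_filler (deg0 A) tau (deg0 A) eps <->
  aug_l ∘ psi tau = aug_l /\ mul A = aug_l ∘ phi tau.
Proof.
rewrite /M12_filler /M1_filler /M2_filler phi_counit psi_counit /=; split.
  case=> _; rewrite -!wl_wr wl1 !tensm1 comp1m !compm1 !wl_comp braidK comp1m.
  move=> /wl_unit_faithful e2 /wl_unit_faithful e3; split.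
    by rewrite /augl -compA e2.
  by rewrite /augl -compA e3 compA lunitVK comp1m.
case=> e1 e2; split.
- apply: lunit_wr_cancel; rewrite !compA lunit_wl -[LHS]compA -!tens_compr.
  rewrite !compA lunitVK comp1m augl_braidV augr_wl_mid -e2.
  apply: (mon_cancell (lunitK A)); rewrite !compA lunitVK comp1m lunit_wlm.
  rewrite -(compA (mul A)) -tens_compr lunit_braid -(compA (mul A)) runit_wl_lunit.
  by rewrite compA lunitVK comp1m mulA.
- rewrite -!wl_wr wl1 tensm1 comp1m !compm1 !wl_comp braidK comp1m; congr (wl _ _).
  by apply: (mon_cancell (lunitK A)); rewrite compA.
- rewrite -!wl_wr tensm1 compm1 wl_comp; congr (wl _ _).
  by apply: (mon_cancell (lunitK A)); rewrite !compA lunitVK comp1m.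
Qed.

End Counit.
End Fillers.

(** * Multiplier bimonoids as images of the nondegenerate simplices *)

Section BimonoidData.
Variable M : braided_category.
Local Notation I := (unit_sg M).

(** The fillers are the conditions for the three nondegenerate 3-simplices other than
    the one treated in [filler_k]. *)
Record catalan_data := CatalanData {
  cd_sg : semigroup M;
  cd_tau : M12_pair cd_sg cd_sg cd_sg;
  cd_eps : M12_pair I cd_sg I;
  cd_fusion : M12_filler cd_tau cd_tau cd_tau cd_tau;
  cd_left : M12_filler cd_eps (deg1 cd_sg) cd_tau (deg1 cd_sg);
  cd_right : M12_filler (deg0 cd_sg) cd_tau (deg0 cd_sg) cd_eps }.

(** The multiplications [m] and [m'] are kept apart because the semigroup rebuilt from a
    multiplier bimonoid agrees with the original one only propositionally, by
    [filler_r], while the objects agree by computation. *)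
Lemma catalan_data_eq (A : M) (m m' : hom (A ⊗ A) A) p p'
    (S := @Semigroup M A m p) (S' := @Semigroup M A m' p')
    (tau : M12_pair S S S) (tau' : M12_pair S' S' S')
    (eps : M12_pair I S I) (eps' : M12_pair I S' I) a l r a' l' r' :
  m = m' -> phi tau = phi tau' -> psi tau = psi tau' ->
  phi eps = phi eps' -> psi eps = psi eps' ->
  @CatalanData S tau eps a l r = @CatalanData S' tau' eps' a' l' r'.
Proof.
move=> mm; rewrite {}/S' {}/S in tau tau' eps eps' a l r a' l' r' *.
case: _ / mm in p' tau' eps' a' l' r' *.
case: _ / (Prop_irrelevance p p') in tau' eps' a' l' r' *.
move=> e1 e2 e3 e4; have e5 := M12_pair_eq e1 e2; have e6 := M12_pair_eq e3 e4.
case: _ / e5 in a' l' r' {e1 e2} *; case: _ / e6 in a' l' r' {e3 e4} *.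
by congr CatalanData; apply: Prop_irrelevance.
Qed.

Lemma multiplier_bimonoid_eq (A : M) (t1 t2 : hom (A ⊗ A) (A ⊗ A)) (e e' : hom A 𝟙)
    p1 p2 p3 p4 p5 p6 q1 q2 q3 q4 q5 q6 : e = e' ->
  @MultiplierBimonoid M A t1 t2 e p1 p2 p3 p4 p5 p6
  = @MultiplierBimonoid M A t1 t2 e' q1 q2 q3 q4 q5 q6.
Proof.
move=> ee; case: _ / ee in q1 q2 q3 q4 q5 q6 *.
by congr MultiplierBimonoid; apply: Prop_irrelevance.
Qed.

Section FromData.
Variable d : catalan_data.
Let A := cd_sg d.
Let e := counit (cd_eps d).

Lemma cd_counit1 : fusion_counit (phi (cd_tau d)) e.
Proof. by apply/fusion_counitE; have /filler_l[] := cd_left d. Qed.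

Lemma cd_counit2 : fusion_rev_counit (psi (cd_tau d)) e.
Proof. by apply/fusion_rev_counitE; have /filler_r[] := cd_right d. Qed.

Lemma cd_mul : runit A ∘ (1_A ⊠ e) ∘ psi (cd_tau d) = lunit A ∘ (e ⊠ 1_A) ∘ phi (cd_tau d).
Proof.
have /filler_l[_ e1] := cd_left d; have /filler_r[_ e2] := cd_right d.
exact: etrans (esym e1) e2.
Qed.

Lemma cd_fusion1 : fusion (phi (cd_tau d)).
Proof. by have [] := cd_fusion d. Qed.

Lemma cd_fusion2 : fusion_rev (psi (cd_tau d)).
Proof. by have [] := cd_fusion d. Qed.

Lemma cd_comm :
  wl A (phi (cd_tau d)) ∘ (psi (cd_tau d) ⊠ 1_A)
  = (psi (cd_tau d) ⊠ 1_A) ∘ wl A (phi (cd_tau d)).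
Proof. by have [_ _ /esym] := cd_fusion d. Qed.

Definition data_bimonoid : multiplier_bimonoid M :=
  MultiplierBimonoid cd_fusion1 cd_fusion2 cd_counit1 cd_counit2 cd_comm cd_mul.

End FromData.

Section FromBimonoid.
Variable b : multiplier_bimonoid M.
Let A := mb_ob b.
Let e := mb_e b.
Let t1 := mb_t1 b.
Let t2 := mb_t2 b.
Let m := augl e A ∘ t1.

Let e1 : augr e A ∘ t1 = augr e A.
Proof. exact/fusion_counitE/mb_counit1. Qed.

Let e2 : augl e A ∘ t2 = augl e A.
Proof. exact/fusion_rev_counitE/mb_counit2. Qed.

Let m2 : m = augr e A ∘ t2.
Proof. exact/esym/mb_mul. Qed.

Definition bimonoid_semigroup : semigroup M := Semigroup (fusion_mulA (mb_fusion1 b) e1).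

Lemma bimonoid_phiP :
  @M1_2simplex M bimonoid_semigroup bimonoid_semigroup bimonoid_semigroup t1.
Proof.
by split; [exact: (fusion_mulr (mb_fusion1 b)) | exact: (fusion_mull _ (mb_fusion1 b))].
Qed.

Lemma bimonoid_psiP :
  @M2_2simplex M bimonoid_semigroup bimonoid_semigroup bimonoid_semigroup t2.
Proof.
rewrite /M2_2simplex /= -/m m2.
by split; [exact: (fusion_rev_mull (mb_fusion2 b)) | exact: (fusion_rev_mulr _ (mb_fusion2 b))].
Qed.

Definition bimonoid_tau :
    M12_pair bimonoid_semigroup bimonoid_semigroup bimonoid_semigroup :=
  M12Pair bimonoid_phiP bimonoid_psiP
    (fusion_mul_compat (m := m) erefl m2 (mb_comm b)).

Lemma bimonoid_e_mul : e ∘ m = e ∘ augl e A.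
Proof. by rewrite aug_aug (fusion_mul_aug e1). Qed.

Definition bimonoid_eps : M12_pair I bimonoid_semigroup I :=
  counit_pair (A := bimonoid_semigroup) bimonoid_e_mul.

Lemma bimonoid_counit : counit bimonoid_eps = e.
Proof. by rewrite /counit /= runit_nat -compA runitVK compm1. Qed.

Definition bimonoid_data : catalan_data.
Proof.
apply: (@CatalanData bimonoid_semigroup bimonoid_tau bimonoid_eps).
- split; [exact: mb_fusion1 | exact: mb_fusion2 | exact/esym/mb_comm].
- by apply/filler_l; rewrite bimonoid_counit.
- by apply/filler_r; rewrite bimonoid_counit.
Defined.

End FromBimonoid.

Lemma bimonoid_dataK : cancel bimonoid_data data_bimonoid.
Proof.
case=> A t1 t2 e p1 p2 p3 p4 p5 p6.
by apply: multiplier_bimonoid_eq; exact: bimonoid_counit.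
Qed.

Lemma data_bimonoidK : cancel data_bimonoid bimonoid_data.
Proof.
case=> [[A m p]] tau eps a l r; apply: catalan_data_eq => //=; last first.
- exact: esym (psi_counit eps).
- exact: esym (phi_counit eps).
by have /filler_r[_ e] := r; exact: esym e.
Qed.

Lemma data_bimonoid_bij : bijective data_bimonoid.
Proof. exact: (Bijective data_bimonoidK bimonoid_dataK). Qed.

End BimonoidData.

(** * Simplices of M12 and of the Catalan simplicial set *)

Local Notation ord3 k := (@Ordinal 3 k isT).
Local Notation ord4 k := (@Ordinal 4 k isT).

Definition catalan_tetra (x0 x1 x2 x3 : catalan2) (i : 'I_4) : catalan2 :=
  match val i with 0 => x0 | 1 => x1 | 2 => x2 | _ => x3 end.

(** The conditions d_j(w_i) = d_i(w_(j+1)) on a 3-boundary, written out for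
    (i, j) = (0, 0), (0, 1), (0, 2), (1, 1), (1, 2), (2, 2). *)
Definition catalan_matching (x0 x1 x2 x3 : catalan2) : Prop :=
  [/\ catalan_face2 (ord3 0) x0 = catalan_face2 (ord3 0) x1,
      catalan_face2 (ord3 1) x0 = catalan_face2 (ord3 0) x2
    & catalan_face2 (ord3 2) x0 = catalan_face2 (ord3 0) x3] /\
  [/\ catalan_face2 (ord3 1) x1 = catalan_face2 (ord3 1) x2,
      catalan_face2 (ord3 2) x1 = catalan_face2 (ord3 1) x3
    & catalan_face2 (ord3 2) x2 = catalan_face2 (ord3 2) x3].

Lemma catalan_tetraP x0 x1 x2 x3 : catalan_matching x0 x1 x2 x3 ->
  forall i j : 'I_3, i <= j ->
    catalan_face2 j (catalan_tetra x0 x1 x2 x3 (ordwid i))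
    = catalan_face2 i (catalan_tetra x0 x1 x2 x3 (ordup j)).
Proof. by case=> -[? ? ?] [? ? ?] [[|[|[|//]]] ?] [[|[|[|//]]] ?]. Qed.

Lemma boundary_matching (w : boundary catalan_face2) :
  catalan_matching (bface (ord4 0) w) (bface (ord4 1) w) (bface (ord4 2) w)
    (bface (ord4 3) w).
Proof.
have E (i j : 'I_3) (i' j' : 'I_4) : i <= j -> val i' = i -> val j' = j.+1 ->
    catalan_face2 j (bface i' w) = catalan_face2 i (bface j' w).
  move=> ij ei ej; have -> : i' = ordwid i by exact: val_inj.
  have -> : j' = ordup j by exact: val_inj.
  exact: svalP w i j ij.
by split; split; apply: E.
Qed.

Section SimplicesOfM12.
Variable M : braided_category.

Lemma M12Simplex2_inj (A12 A02 A01 : semigroup M) (p q : M12_pair A12 A02 A01) :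
  M12Simplex2 p = M12Simplex2 q -> p = q.
Proof. by case=> e; apply: inj_pair2 (inj_pair2 _ _ _ _ _ (inj_pair2 _ _ _ _ _ e)). Qed.

(** Edges of a 2-simplex obtained from a simplicial map are known only up to
    propositional equality; this moves them into the type. *)
Lemma M12_2simplex_edges (w : M12_2simplex M) (A12 A02 A01 : semigroup M) :
  edge12 w = A12 -> edge02 w = A02 -> edge01 w = A01 ->
  exists p : M12_pair A12 A02 A01, w = M12Simplex2 p.
Proof. by case: w => B12 B02 B01 p /= <- <- <-; exists p. Qed.

Lemma M12_face3_filler (y : M12_3simplex M) (A23 A13 A12 A03 A02 A01 : semigroup M)
    (w123 : M12_pair A23 A13 A12) (w023 : M12_pair A23 A03 A02)
    (w013 : M12_pair A13 A03 A01) (w012 : M12_pair A12 A02 A01) :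
  M12_face3 (ord4 0) y = M12Simplex2 w123 -> M12_face3 (ord4 1) y = M12Simplex2 w023 ->
  M12_face3 (ord4 2) y = M12Simplex2 w013 -> M12_face3 (ord4 3) y = M12Simplex2 w012 ->
  M12_filler w123 w023 w013 w012.
Proof.
case: y => B23 B13 B12 B03 B02 B01 v123 v023 v013 v012 f /= e0 e1 e2 e3.
have [E23 E13 E12] := And3 (congr1 (@edge12 M) e0) (congr1 (@edge02 M) e0)
  (congr1 (@edge01 M) e0).
have [E03 E02 E01] := And3 (congr1 (@edge02 M) e1) (congr1 (@edge01 M) e1)
  (congr1 (@edge01 M) e2).
move: E23 E13 E12 E03 E02 E01 => /= E23 E13 E12 E03 E02 E01.
subst B23 B13 B12 B03 B02 B01.
by rewrite -(M12Simplex2_inj e0) -(M12Simplex2_inj e1) -(M12Simplex2_inj e2)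
  -(M12Simplex2_inj e3).
Qed.

Lemma M12_face3_separated : separated (@M12_face3 M).
Proof.
move=> y [B23 B13 B12 B03 B02 B01 v123 v023 v013 v012 f] e.
move: {e} (e (ord4 0)) (e (ord4 1)) (e (ord4 2)) (e (ord4 3)).
case: y => B23' B13' B12' B03' B02' B01' w123 w023 w013 w012 f' /= e0 e1 e2 e3.
have [E23 E13 E12] := And3 (congr1 (@edge12 M) e0) (congr1 (@edge02 M) e0)
  (congr1 (@edge01 M) e0).
have [E03 E02 E01] := And3 (congr1 (@edge02 M) e1) (congr1 (@edge01 M) e1)
  (congr1 (@edge01 M) e2).
move: E23 E13 E12 E03 E02 E01 => /= E23 E13 E12 E03 E02 E01.
subst B23' B13' B12' B03' B02' B01'.
by apply: M12_3simplex_eq; apply: M12Simplex2_inj.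
Qed.

End SimplicesOfM12.

(** * Simplicial maps out of the Catalan simplicial set *)

Section MapOfData.
Variables (M : braided_category) (d : catalan_data M).
Let A := cd_sg d.

Definition data_map1 (x : catalan1) : semigroup M :=
  match x with cat_pt1 => unit_sg M | cat_alpha => A end.

Definition data_map2 (x : catalan2) : M12_2simplex M :=
  match x with
  | cat_pt2 => M12Simplex2 (deg0 (unit_sg M))
  | cat_s0alpha => M12Simplex2 (deg0 A)
  | cat_s1alpha => M12Simplex2 (deg1 A)
  | cat_tau => M12Simplex2 (cd_tau d)
  | cat_eps => M12Simplex2 (cd_eps d)
  end.

Lemma data_map_face2 i x : data_map1 (catalan_face2 i x) = M12_face2 i (data_map2 x).
Proof. by case: i x => [[|[|[|//]]] ?] []. Qed.

Lemma data_map_degen1 i x : data_map2 (catalan_degen1 i x) = M12_degen1 i (data_map1 x).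
Proof.
by case: i x => [[|[|//]] ?] []; rewrite /data_map2 /M12_degen1 //= deg01_unit.
Qed.

Lemma data_map_filler (w : boundary catalan_face2) :
  exists y, forall i, data_map2 (bface i w) = M12_face3 i y.
Proof.
suff [y [y0 y1 y2 y3]] : exists y,
    [/\ data_map2 (bface (ord4 0) w) = M12_face3 (ord4 0) y,
        data_map2 (bface (ord4 1) w) = M12_face3 (ord4 1) y,
        data_map2 (bface (ord4 2) w) = M12_face3 (ord4 2) y
      & data_map2 (bface (ord4 3) w) = M12_face3 (ord4 3) y].
  exists y => i; have : [\/ i = ord4 0, i = ord4 1, i = ord4 2 | i = ord4 3].
    by case: i => [[|[|[|[|//]]]] ?];
      [constructor 1|constructor 2|constructor 3|constructor 4]; apply: val_inj.
  by case=> ->.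
have := boundary_matching w; rewrite /catalan_matching /catalan_face2 /M12_face3 /=.
move: (bface (ord4 0) w) (bface (ord4 1) w) (bface (ord4 2) w) (bface (ord4 3) w).
move=> x0 x1 x2 x3 [[+ + +] [+ + +]].
(* Of the 625 quadruples of 2-simplices, 14 match. *)
case: x0; case: x1 => //; case: x2 => //; case: x3 => // _ _ _ _ _ _.
(* The first four candidates fill the nondegenerate boundaries, the others are
   degeneracies of 2-simplices; s_0 and s_1 agree on the trivial semigroup. *)
all: rewrite /data_map2 ?deg01_unit.
all: first
  [ by exists (M12Simplex3 (cd_fusion d))
  | by exists (M12Simplex3 (cd_left d))
  | by exists (M12Simplex3 (cd_right d))
  | by exists (M12Simplex3 (filler_k (cd_eps d)))
  | by exists (M12Simplex3 (deg20_P (cd_tau d)))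
  | by exists (M12Simplex3 (deg21_P (cd_tau d)))
  | by exists (M12Simplex3 (deg22_P (cd_tau d)))
  | by exists (M12Simplex3 (deg20_P (deg0 A)))
  | by exists (M12Simplex3 (deg20_P (deg1 A)))
  | by exists (M12Simplex3 (deg21_P (deg0 A))); rewrite /= ?deg01_unit
  | by exists (M12Simplex3 (deg22_P (deg1 A))); rewrite /= ?deg01_unit
  | by exists (M12Simplex3 (deg20_P (cd_eps d))); rewrite /= ?deg01_unit
  | by exists (M12Simplex3 (deg21_P (cd_eps d))); rewrite /= ?deg01_unit
  | by exists (M12Simplex3 (deg22_P (cd_eps d))); rewrite /= ?deg01_unit
  | by exists (M12Simplex3 (deg20_P (deg0 (unit_sg M)))); rewrite /= ?deg01_unit].
Qed.

Definition data_map3 (w : boundary catalan_face2) : M12_3simplex M :=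
  sval (cid (data_map_filler w)).

Lemma data_map_face3 i w : data_map2 (bface i w) = M12_face3 i (data_map3 w).
Proof. exact: (svalP (cid (data_map_filler w))). Qed.

Definition data_trunc_map : trunc3_map catalan_trunc (M12_trunc M).
Proof.
apply: (@Trunc3Map _ catalan_trunc (M12_trunc M) id data_map1 data_map2 data_map3
  _ data_map_face2 data_map_face3 _ data_map_degen1) => //.
apply: (degen_transfer (t_ds_eq2 (t := catalan_trunc)) (t_ds2 (t := catalan_trunc))
  (t_ds_eq2 (t := M12_trunc M)) (t_ds2 (t := M12_trunc M))
  data_map_face2 data_map_face3 data_map_degen1).
exact: M12_face3_separated.
Defined.

Definition data_smap : smap catalan (M12 M) := coskeletal_map data_trunc_map.

End MapOfData.

Lemma data_smap_inj (M : braided_category) : injective (@data_smap M).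
Proof.
move=> [A tau eps a l r] [A' tau' eps' a' l' r'] e.
have eA : A = A' := congr1 (fun F : smap catalan (M12 M) => F 1 cat_alpha) e.
case: _ / eA in tau' eps' a' l' r' e *.
have /M12Simplex2_inj etau : M12Simplex2 tau = M12Simplex2 tau' :=
  congr1 (fun F : smap catalan (M12 M) => F 2 cat_tau) e.
have /M12Simplex2_inj eeps : M12Simplex2 eps = M12Simplex2 eps' :=
  congr1 (fun F : smap catalan (M12 M) => F 2 cat_eps) e.
case: _ / etau in a' l' r' {e} *; case: _ / eeps in l' r' *.
by congr CatalanData; apply: Prop_irrelevance.
Qed.

(** Images of the degenerate edge, s_0(alpha) and s_1(alpha) are forced by compatibility with the
    degeneracies, and the three fillers are images of Catalan 3-simplices. *)
Section DataOfMap.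
Variables (M : braided_category) (F : smap catalan (M12 M)).
Local Notation I := (unit_sg M).

Let F1 (x : catalan1) : semigroup M := F 1 x.
Let F2 (x : catalan2) : M12_2simplex M := F 2 x.
Let A := F1 cat_alpha.

Let F1_pt : F1 cat_pt1 = I.
Proof. exact: (smap_degen F (ord0 : 'I_1) (tt : catalan 0)). Qed.

Let F2_face i x : F1 (catalan_face2 i x) = M12_face2 i (F2 x).
Proof. exact: (smap_face F (i : 'I_3) (x : catalan 2)). Qed.

Let F2_degen i x : F2 (catalan_degen1 i x) = M12_degen1 i (F1 x).
Proof. exact: (smap_degen F (i : 'I_2) (x : catalan 1)). Qed.

Let F2_pt : F2 cat_pt2 = M12Simplex2 (deg0 I).
Proof. by rewrite (F2_degen ord0 cat_pt1) F1_pt. Qed.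

Let F2_s0 : F2 cat_s0alpha = M12Simplex2 (deg0 A).
Proof. exact: (F2_degen ord0 cat_alpha). Qed.

Let F2_s1 : F2 cat_s1alpha = M12Simplex2 (deg1 A).
Proof. exact: (F2_degen ord_max cat_alpha). Qed.

Let F2_tau : exists tau : M12_pair A A A, F2 cat_tau = M12Simplex2 tau.
Proof.
by apply: M12_2simplex_edges; [have := F2_face (ord3 0) cat_tau
 | have := F2_face (ord3 1) cat_tau | have := F2_face (ord3 2) cat_tau].
Qed.

Let F2_eps : exists eps : M12_pair I A I, F2 cat_eps = M12Simplex2 eps.
Proof.
by apply: M12_2simplex_edges; rewrite -?F1_pt; [have := F2_face (ord3 0) cat_eps
 | have := F2_face (ord3 1) cat_eps | have := F2_face (ord3 2) cat_eps].
Qed.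

Let F_filler (A23 A13 A12 A03 A02 A01 : semigroup M) (x0 x1 x2 x3 : catalan2)
    (w123 : M12_pair A23 A13 A12) (w023 : M12_pair A23 A03 A02)
    (w013 : M12_pair A13 A03 A01) (w012 : M12_pair A12 A02 A01) :
  F2 x0 = M12Simplex2 w123 -> F2 x1 = M12Simplex2 w023 ->
  F2 x2 = M12Simplex2 w013 -> F2 x3 = M12Simplex2 w012 ->
  catalan_matching x0 x1 x2 x3 ->
  M12_filler w123 w023 w013 w012.
Proof.
move=> e0 e1 e2 e3 c.
pose w : catalan 3 := exist _ _ (catalan_tetraP c).
apply: (@M12_face3_filler _ (F 3 w)).
- by rewrite -e0; exact: esym (smap_face F (ord4 0) w).
- by rewrite -e1; exact: esym (smap_face F (ord4 1) w).
- by rewrite -e2; exact: esym (smap_face F (ord4 2) w).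
- by rewrite -e3; exact: esym (smap_face F (ord4 3) w).
Qed.

Lemma data_smap_surj : exists d, data_smap d = F.
Proof.
have [tau tauE] := F2_tau; have [eps epsE] := F2_eps.
have a := F_filler tauE tauE tauE tauE (conj (And3 erefl erefl erefl) (And3 erefl erefl erefl)).
have l := F_filler epsE F2_s1 tauE F2_s1 (conj (And3 erefl erefl erefl) (And3 erefl erefl erefl)).
have r := F_filler F2_s0 tauE F2_s0 epsE (conj (And3 erefl erefl erefl) (And3 erefl erefl erefl)).
exists (CatalanData a l r); apply: smap_coskeletal_eq.
- exact: M12_face3_separated.
- by move=> x; case: (F 0 x); case: (data_smap _ 0 x).
- by case; [exact: esym F1_pt | ].
- by case; apply: esym; [exact: F2_pt | exact: F2_s0 | exact: F2_s1 | exact: tauE | exact: epsE].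
Qed.

End DataOfMap.

(** * The bijection *)

Theorem theorem3p5 (C : braided_category) :
  exists F : smap catalan (M12 C) -> multiplier_bimonoid C, bijective F.
Proof.
have [G GK] := choice (@data_smap_surj C).
exists (@data_bimonoid C \o G); apply: bij_comp (data_bimonoid_bij C) _.
exact: Bijective GK (inj_can_sym GK (@data_smap_inj C)).
Qed.
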